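(* Let $\mathbb{U}$ be a Banach Lie group, $d$ a fixed metric on $\mathbb{U}$ as described in the context, and $S\subseteq \mathbb{U}$ an ad-bounded subset. (1) For every $\varepsilon>0$ there is some $\delta>0$ such that, for every compact group $\mathbb{K}$ and every continuous map $\varphi:\mathbb{K}\to\mathbb{U}$ with $\varphi(\mathbb{K})\subseteq S$ and $$d(\varphi(st),\ \varphi(s)\varphi(t))<\delta\quad\text{for all } s,t\in\mathbb{K},$$ there is a morphism $\psi:\mathbb{K}\to\mathbb{U}$ that is $\varepsilon$-close to $\varphi$. (2) Let $\mathbb{G}\le\mathbb{U}$ be a Lie subgroup. For every $\varepsilon>0$ there is a neighborhood $U$ of the identity $1\in\mathbb{U}$ such that, for every compact group $\mathbb{K}$ and every morphism $\varphi:\mathbb{K}\to\mathbb{U}$ with $\varphi(\mathbb{K})\subset(\mathbb{G}\cdot U)\cap S$, $\varphi$ is $\varepsilon$-close to a morphism $\mathbb{K}\to\mathbb{G}$; and if moreover $\varphi$ is an embedding, then $\varphi$ is $\varepsilon$-close to an embedding $\mathbb{K}\to\mathbb{G}$.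
   Context: A Banach Lie group is a topological group that is also a (possibly infinite-dimensional) analytic Banach manifold, with analytic multiplication and inversion. Its Lie algebra $\mathfrak{u}=Lie(\mathbb{U})$ is a Banach space carrying the adjoint representation $\mathrm{Ad}:\mathbb{U}\to GL(\mathfrak{u})$. A subset $S\subseteq\mathbb{U}$ is ad-bounded if $\mathrm{Ad}(S)\subset GL(\mathfrak{u})$ is bounded in operator norm. A Lie subgroup of $\mathbb{U}$ is meant in the strong (Bourbaki) sense: a subgroup that is an (embedded, split) submanifold; in particular it is closed, is a Banach Lie group in its own right, and its Lie algebra is a complemented closed subspace of $\mathfrak{u}$. $d$ is a fixed complete metric inducing the topology of $\mathbb{U}$, chosen left-invariant or right-invariant. Morphisms of topological groups are continuous group homomorphisms; an embedding of a compact group is an injective morphism. Compact groups are Hausdorff. $\mathbb{G}\cdot U=\{gu : g\in\mathbb{G},\ u\in U\}$. Two continuous maps $\varphi,\psi:\mathbb{K}\to\mathbb{U}$ from a compact group are $\varepsilon$-close if $\sup_{s\in\mathbb{K}}d(\varphi(s),\psi(s))<\varepsilon$; a map into $\mathbb{G}$ is regarded as a map into $\mathbb{U}$. *)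

(* Defs.v *)
From HB Require Import structures.
From mathcomp Require Import all_boot all_order all_algebra.
From mathcomp Require Import all_classical all_reals all_analysis.

Set Implicit Arguments.
Unset Strict Implicit.
Unset Printing Implicit Defensive.

Import Order.TTheory GRing.Theory Num.Theory.
Import numFieldNormedType.Exports.

Local Open Scope classical_set_scope.
Local Open Scope ring_scope.

HB.mixin Record isTopologicalGroup G of Group G & Topological G := {
  mulg_continuous : continuous (fun p : G * G => (p.1 * p.2)%g) ;
  invg_continuous : continuous (fun x : G => (x^-1)%g)
}.

#[short(type="topGroupType")]
HB.structure Definition TopologicalGroup :=
  {G of isTopologicalGroup G & Group G & Topological G}.

Definition compact_group (K : topGroupType) : Prop :=
  compact [set: K] /\ hausdorff_space K.

Definition top_morphism (K L : topGroupType) (f : K -> L) : Prop :=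
  continuous f /\ {morph f : x y / (x * y)%g}.

Definition embedding (K L : topGroupType) (f : K -> L) : Prop :=
  top_morphism f /\ injective f.

Definition is_subgroup (L : topGroupType) (G : set L) : Prop :=
  [/\ G 1%g, forall x y, G x -> G y -> G (x * y)%g & forall x, G x -> G (x^-1)%g].

Section Analytic.
Variables (R : realType) (V W : normedModType R).

Definition multilinear n (a : ('I_n -> V) -> W) : Prop :=
  forall (v : 'I_n -> V) (i : 'I_n) (c : R) (x y : V),
    a [eta v with i |-> c *: x + y] =
    c *: a [eta v with i |-> x] + a [eta v with i |-> y].

(* The bound says that the norm of the n-linear map a n is at most C * r ^- n,
   i.e. the power series has a positive radius of convergence (at least r). *)
Definition analytic_at (f : V -> W) (x : V) : Prop :=
  exists (a : forall n, ('I_n -> V) -> W) (C r : R),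
    [/\ 0 < r,
        forall n, multilinear (a n),
        forall n (v : 'I_n -> V), `|a n v| <= C * r ^- n * \prod_i `|v i| &
        forall h : V, `|h| < r ->
          series (fun n => a n (fun=> h)) @ \oo --> f (x + h)].

End Analytic.

(* Only the values of coord on dom, and of coord_inv on coord @` dom, matter. *)
Record chart (R : realType) (M : topologicalType) (E : normedModType R) := Chart {
  dom : set M ;
  coord : M -> E ;
  coord_inv : E -> M ;
  dom_open : open dom ;
  coord_open : open (coord @` dom) ;
  coordK : forall x, dom x -> coord_inv (coord x) = x ;
  coord_continuous : forall x, dom x -> {for x, continuous coord} ;
  coord_inv_continuous : forall x, dom x -> {for coord x, continuous coord_inv}
}.

Definition compatible (R : realType) (M : topologicalType) (E : normedModType R)
    (c c' : chart M E) : Prop :=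
  forall x, dom c x -> dom c' x ->
    analytic_at (fun y => coord c' (coord_inv c y)) (coord c x) /\
    analytic_at (fun y => coord c (coord_inv c' y)) (coord c' x).

(* The atlas is a family of pairwise compatible charts, with a chosen chart
   around each point.  A single model space loses no generality, since all
   tangent spaces of a Lie group are isomorphic through translations.  Scalars
   are real: complex Lie groups and subgroups are in particular real ones. *)
Record banachLieGroup (R : realType) := BanachLieGroup {
  blg_group :> topGroupType ;
  blg_model : completeNormedModType R ;
  chart_at : blg_group -> chart blg_group blg_model ;
  chart_at_dom : forall x, dom (chart_at x) x ;
  chart_at_compatible : forall x y, compatible (chart_at x) (chart_at y) ;
  mulg_analytic : forall x y : blg_group,
    analytic_at (fun z : blg_model * blg_model =>
        coord (chart_at (x * y)%g)
          (coord_inv (chart_at x) z.1 * coord_inv (chart_at y) z.2)%g)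
      (coord (chart_at x) x, coord (chart_at y) y) ;
  invg_analytic : forall x : blg_group,
    analytic_at (fun z : blg_model =>
        coord (chart_at (x^-1)%g) ((coord_inv (chart_at x) z)^-1)%g)
      (coord (chart_at x) x)
}.

Section LieGroup.
Variables (R : realType) (U : banachLieGroup R).

(* The tangent space at 1, identified with the model space through the chart
   chosen at 1.  Another chart would replace the norm by an equivalent one and
   conjugate Ad by a fixed isomorphism. *)
Definition lie_algebra : completeNormedModType R := blg_model U.

Definition Ad (g : U) : lie_algebra -> lie_algebra :=
  let c := chart_at (1%g : U) in
  'd (fun x : lie_algebra => coord c (g * coord_inv c x * g^-1)%g) (coord c 1%g).

Definition op_norm (f : lie_algebra -> lie_algebra) : \bar R :=
  ereal_sup [set `|f x|%:E | x in [set x : lie_algebra | `|x| <= 1]].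

Definition ad_bounded (S : set U) : Prop :=
  exists M : R, forall g, S g -> (op_norm (Ad g) <= M%:E)%E.

(* A chart of the maximal atlas. *)
Definition admissible (c : chart U (blg_model U)) : Prop :=
  forall x, compatible c (chart_at x).

End LieGroup.

Definition closed_subspace (R : realType) (E : normedModType R) (F : set E) : Prop :=
  [/\ closed F, F 0 & forall (a : R) x y, F x -> F y -> F (a *: x + y)].

Definition complemented (R : realType) (E : normedModType R) (F : set E) : Prop :=
  closed_subspace F /\
  exists F' : set E, [/\ closed_subspace F', F `&` F' = [set 0] &
    forall x, exists y z, [/\ F y, F' z & x = y + z]].

Definition split_submanifold (R : realType) (U : banachLieGroup R) (Y : set U) : Prop :=
  forall y, Y y -> exists (c : chart U (blg_model U)) (F : set (blg_model U)),
    [/\ admissible c, dom c y, complemented F &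
        coord c @` (dom c `&` Y) = coord c @` dom c `&` F].

Definition lie_subgroup (R : realType) (U : banachLieGroup R) (G : set U) : Prop :=
  is_subgroup G /\ split_submanifold G.

Record complete_metric (R : realType) (M : topologicalType) (d : M -> M -> R) : Prop := {
  metric_eq0 : forall x y, d x y = 0 <-> x = y ;
  metric_sym : forall x y, d x y = d y x ;
  metric_triangle : forall x y z, d x z <= d x y + d y z ;
  metric_nbhs : forall x (A : set M),
    nbhs x A <-> exists2 e : R, 0 < e & [set y | d x y < e] `<=` A ;
  metric_complete : forall u : nat -> M,
    (forall e : R, 0 < e -> exists N, forall m n, (N <= m)%N -> (N <= n)%N ->
       d (u m) (u n) < e) ->
    exists l : M, u @ \oo --> l
}.

Definition left_invariant (R : realType) (L : topGroupType) (d : L -> L -> R) : Prop :=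
  forall g x y, d (g * x)%g (g * y)%g = d x y.

Definition right_invariant (R : realType) (L : topGroupType) (d : L -> L -> R) : Prop :=
  forall g x y, d (x * g)%g (y * g)%g = d x y.

(* The supremum is taken in \bar R, since sup is 0 on unbounded real sets. *)
Definition eps_close (R : realType) (L : Type) (d : L -> L -> R) (eps : R)
    (K : Type) (f g : K -> L) : Prop :=
  (ereal_sup (range (fun s => (d (f s) (g s))%:E)) < eps%:E)%E.

(* Main.v *)
(** Everything is computed in a chart at the identity, where the product is
    [x + y] up to an error [O(|x||y|)].  Cutting a segment into small pieces
    shows that conjugation by an element with bounded adjoint action is Lipschitz
    near the identity, with uniform constants, and commutes with averages up to
    second order; the exponential map is not needed.

    Haar integrals are replaced by finite averages over a net [t_i] of the
    compact group that is almost invariant under left translations: minimal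
    coverings by translates of a small set are matched by Hall's theorem.

    (1) If [phi (s t) = phi s * ci (x s t) * phi t] with [x] small, multiplying
    [phi s] by the average of [x s (t_i)] makes the defect quadratically
    smaller; iterate.

    (2) If [phi s] lies in [ci (y s) G] with [y] small, conjugating [phi] by the
    average of [y (t_i)] makes the distance to [G] quadratically smaller.
    The limit is a conjugate of [phi] with values in [G], which is injective as
    soon as [phi] is. *)
Require Import Defs.
From HB Require Import structures.
From mathcomp Require Import all_boot all_order all_algebra.
From mathcomp Require Import all_classical all_reals all_analysis.
From mathcomp Require Import lra ring.

Set Implicit Arguments.
Unset Strict Implicit.
Unset Printing Implicit Defensive.

Import Order.TTheory GRing.Theory Num.Theory.
Import numFieldNormedType.Exports.

(** The obstacle is uniformity: [delta] and the neighbourhood of the identity may depend on a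
    Lipschitz constant [L] for conjugation, but neither on the compact group nor on the map. The
    net, by contrast, is chosen after the map and anew at every step, since no estimate depends on
    its cardinality.

    The quadratic gain is only used as a halving: when the defect is below a fixed multiple of
    [L^-2], one step divides it by two, so the corrections are dominated by a geometric series.
    Their sum stays small, hence every iterate differs from the original map by factors near the
    identity, and a single constant ([4 L] in part 1, [16 L] in part 2) is a Lipschitz constant for
    conjugation by the values of all iterates. Bounded adjoint action is thus required of the
    original map alone. *)

(* Rado's argument: in a family that is minimal for Hall's condition every
   [r i] is a singleton, since two removable elements would contradict the
   submodularity of cardinals. *)
Lemma hall_marriage (S T : finType) (r : S -> {set T}) :
  (forall A : {set S}, #|A| <= #|\bigcup_(i in A) r i|)%N ->
  exists2 f : S -> T, injective f & forall i, f i \in r i.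
Proof.
have [n] := ubnP (\sum_i #|r i|)%N; elim: n r => // n IH r ltn hall.
have hall1 i : (0 < #|r i|)%N.
  by have := hall [set i]; rewrite cards1 big_set1.
have [[i /existsP [x /existsP [y /and3P [xr yr xy]]]]|nex] :=
  pselect (exists i, [exists x, exists y, [&& x \in r i, y \in r i & x != y]]); last first.
  have r1 i : exists x, r i == [set x].
    have /card_gt0P [x xr] := hall1 i; exists x.
    apply/eqP/setP => y; rewrite inE; apply/idP/eqP => [yr|-> //].
    apply: contra_notP nex => /eqP yx; exists i; apply/existsP; exists y.
    by apply/existsP; exists x; rewrite xr yr.
  pose f i := xchoose (r1 i); have rf i : r i = [set f i] by apply/eqP/(xchooseP (r1 i)).
  exists f => [i j fij|i]; last by rewrite rf set11.
  apply/eqP; apply: contraTT isT => ij.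
  have := hall [set i; j]; rewrite cards2 ij big_setU1 ?inE //= big_set1 !rf fij.
  by rewrite finset.setUid cards1.
pose rm z j := if j == i then r i :\ z else r j.
have rmi z : rm z i = r i :\ z by rewrite /rm eqxx.
have rmS z j : rm z j \subset r j by rewrite /rm; case: eqP => // ->; exact: subsetDl.
have rmn z j : j != i -> rm z j = r j by rewrite /rm => /negbTE ->.
have rmI z : z \in r i -> (\sum_j #|rm z j| < n)%N.
  move=> zr; rewrite -ltnS; apply: leq_trans ltn; rewrite ltnS.
  rewrite (bigD1 i) //= [ltnRHS](bigD1 i) //= {1}/rm eqxx (cardsD1 z (r i)) zr.
  by rewrite -addSn leq_add2l; apply: leq_sum => j _; apply/subset_leq_card/rmS.
(* If removing [z] from [r i] breaks Hall's condition, the violating set contains [i]. The set [A]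
   below is that set without [i], which turns the strict inequality into a large one. *)
have step z : z \in r i ->
    (exists2 f : S -> T, injective f & forall j, f j \in r j) \/
    exists2 A : {set S}, i \notin A &
      (#|\bigcup_(j in A) r j :|: (r i :\ z)| <= #|A|)%N.
  move=> zr; have [/IH|/existsNP [A /negP]] :=
    pselect (forall A : {set S}, #|A| <= #|\bigcup_(j in A) rm z j|)%N.
    case/(_ (rmI z zr)) => f fi fr; left; exists f => // j.
    exact: (fintype.subsetP (rmS z j)).
  rewrite -ltnNge => ltA; right; exists (A :\ i); first by rewrite !inE eqxx.
  have iA : i \in A.
    apply: contraTT ltA => iA; rewrite -leqNgt (leq_trans (hall A)) //.
    rewrite (eq_bigr (rm z)) // => j jA; rewrite rmn //.
    by apply: contraNneq iA => <-.
  rewrite -ltnS; move: ltA; rewrite (cardsD1 i A) iA add1n.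
  rewrite (big_setD1 i) //= finset.setUC rmi (eq_bigr r) // => j.
  by rewrite !inE => /andP [ji _]; rewrite rmn.
have [//|[A iA cA]] := step x xr; have [//|[B iB cB]] := step y yr.
(* Hall's condition for [i |: (A :|: B)] and for [A :&: B], combined with the next two inclusions,
   yields [#|A| + #|B| + 1 <= #|A| + #|B|]. The first inclusion rests on [x != y]: no element of
   [r i] is removed on both sides. *)
have uAB : \bigcup_(j in i |: (A :|: B)) r j \subset
   (\bigcup_(j in A) r j :|: (r i :\ x)) :|: (\bigcup_(j in B) r j :|: (r i :\ y)).
  apply/fintype.subsetP => z /bigcupP [j]; rewrite !inE => /or3P [/eqP ->|jA|jB] zr.
  - by rewrite zr !andbT; case: (eqVneq z x) => [->|_]; rewrite ?xy ?orbT.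
  - by apply/orP; left; apply/orP; left; apply/bigcupP; exists j.
  - by apply/orP; right; apply/orP; left; apply/bigcupP; exists j.
have iAB : \bigcup_(j in A :&: B) r j \subset
   (\bigcup_(j in A) r j :|: (r i :\ x)) :&: (\bigcup_(j in B) r j :|: (r i :\ y)).
  apply/fintype.subsetP => z /bigcupP [j]; rewrite !inE => /andP [jA jB] zr.
  by apply/andP; split; apply/orP; left; apply/bigcupP; exists j.
have := leq_add (leq_trans (hall _) (subset_leq_card uAB))
                (leq_trans (hall _) (subset_leq_card iAB)).
rewrite cardsUI cardsU1 !inE negb_or iA iB andbT add1n addSn cardsUI.
by move=> /leq_trans /(_ (leq_add cA cB)); rewrite ltnn.
Qed.

Local Open Scope classical_set_scope.
Local Open Scope ring_scope.

(** * Averaging nets in compact groups *)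

Lemma nbhs_mulg (G : topGroupType) (x y : G) (A : set G) : nbhs (x * y)%g A ->
  exists B C : set G, [/\ nbhs x B, nbhs y C & forall b c, B b -> C c -> A (b * c)%g].
Proof.
move=> /(mulg_continuous (x, y)) [[B C] /= [Bx Cy] BC].
by exists B, C; split => // b c Bb Cc; apply: (BC (b, c)).
Qed.

Lemma cvg_mulg (T : Type) (F : set_system T) {FF : Filter F} (G : topGroupType)
  (f g : T -> G) (a b : G) :
  f @ F --> a -> g @ F --> b -> (fun t => f t * g t)%g @ F --> (a * b)%g.
Proof.
by move=> fa gb; apply: (cvg_comp2 fa gb); exact: (mulg_continuous (a, b)).
Qed.

Lemma cvg_invg (T : Type) (F : set_system T) {FF : Filter F} (G : topGroupType)
  (f : T -> G) (a : G) : f @ F --> a -> (fun t => (f t)^-1)%g @ F --> (a^-1)%g.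
Proof. by move=> fa; apply: (cvg_comp _ _ fa); exact: invg_continuous. Qed.

(* Two coverings of minimal cardinality by translates of a small set are in
   bijection, by Hall's theorem; [t] and [u * t] are two such coverings. *)
Lemma averaging_net (K : topGroupType) (W : set K) :
  compact [set: K] -> nbhs (1%g : K) W ->
  exists (n : nat) (t : 'I_n.+1 -> K), forall u,
    exists2 s : 'I_n.+1 -> 'I_n.+1, injective s &
      forall i, W ((u * t i)^-1 * t (s i))%g.
Proof.
move=> Kc nW.
have [V nV VW] : exists2 V : set K, nbhs (1%g : K) V &
    forall a b, V a -> V b -> W (a * b^-1)%g.
  have : nbhs (1 * 1^-1)%g W by rewrite mulgV.
  case/nbhs_mulg => B [C [nB nC BC]]; exists (B `&` (fun x => x^-1)%g @^-1` C).
    by apply: filterI => //; exact: (invg_continuous (1%g : K)).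
  by move=> a b [Ba _] [_ Cb]; exact: BC.
pose covers (s : seq K) := forall x, exists2 t, t \in s & V (t^-1 * x)%g.
have cov : exists s, covers s.
  (* [F] is the filter of properties shared by all lists containing some finite list; compactness,
     as a near-covering property, then produces one list that covers. *)
  pose F (P : set (seq K)) := exists s0 : seq K, forall s, {subset s0 <= s} -> P s.
  have FF : Filter F.
    split; first by exists [::].
    - move=> P Q [s sP] [s' sQ]; exists (s ++ s') => r sr.
      by split; [apply: sP|apply: sQ] => x xs; apply: sr; rewrite mem_cat xs ?orbT.
    - by move=> P Q PQ [s sP]; exists s => r /sP /PQ.
  move: Kc => /compact_near_coveringP.
  move=> /(_ _ F (fun s x => exists2 t, t \in s & V (t^-1 * x)%g) FF) [x _|s cs].
    exists ((fun y => x^-1 * y)%g @^-1` V, [set s : seq K | x \in s]); last first.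
      by move=> [y s] [/= Vy xs]; exists x.
    split => /=; last by exists [:: x] => s; apply; rewrite inE.
    have : (fun y => x^-1 * y)%g @ x --> (x^-1 * x)%g.
      by apply: cvg_mulg; [exact: cvg_cst|exact: cvg_id].
    by apply; rewrite mulVg.
  by exists s => x; exact: cs.
pose P n := `[< exists2 s, covers s & size s = n >].
have exP : exists n, P n by case: cov => s cs; exists (size s); apply/asboolP; exists s.
case: (ex_minnP exP) => -[|n] /asboolP [s cs sn] nmin.
  by have [t] := cs 1%g; rewrite (size0nil sn).
pose t (i : 'I_n.+1) := nth 1%g s i; exists n, t => u.
have tcov x : exists i, V ((t i)^-1 * x)%g.
  have [y ys Vy] := cs x; have lty : (index y s < n.+1)%N by rewrite -sn index_mem.
  by exists (Ordinal lty); rewrite /t /= nth_index.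
(* [i] and [j] are related when the translates of [V] by [u * t i] and by [t j] meet; a common point
   puts [(u * t i)^-1 * t j] in [V V^-1], hence in [W]. *)
pose r i := finset (fun j => `[< exists x, V ((u * t i)^-1 * x)%g /\ V ((t j)^-1 * x)%g >]).
have [A|f fi fr] := @hall_marriage _ _ r; last first.
  exists f => // i; have := fr i; rewrite inE => /asboolP [x [Vi Vj]].
  by have := VW _ _ Vi Vj; rewrite (invgM (t (f i))^-1%g) invgK mulgA mulgK.
rewrite leqNgt; apply/negP => ltA.
(* If [A] violates Hall's condition, replacing the translates [u * t i] with [i] in [A] by their
   fewer neighbours [t j] still covers the group, against the minimality of [n.+1]. *)
pose s' := [seq (u * t i)%g | i <- enum (finset.setC A)] ++
           [seq t j | j <- enum (\bigcup_(i in A) r i)%SET].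
suff /nmin : P (size s').
  rewrite size_cat !size_map -!cardE leqNgt => /negP; apply.
  by rewrite -[ltnRHS]card_ord -(cardsC A) addnC ltn_add2r.
apply/asboolP; exists s' => // x.
have [i] := tcov (u^-1 * x)%g; rewrite mulgA -invgM => Vi.
have [iA|iA] := boolP (i \in A).
  have [j Vj] := tcov x; exists (t j) => //; rewrite mem_cat; apply/orP; right.
  apply: map_f; rewrite mem_enum; apply/finset.bigcupP; exists i => //.
  by rewrite inE; apply/asboolP; exists x.
exists (u * t i)%g => //; rewrite mem_cat; apply/orP; left.
by apply: map_f; rewrite mem_enum inE.
Qed.

(** * Averages and coordinates near the identity *)

Section Mean.
Variables (R : realType) (E : normedModType R).

Definition mean n (x : 'I_n.+1 -> E) : E := n.+1%:R^-1 *: \sum_i x i.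

Lemma mean_cst n (c : E) : mean (fun _ : 'I_n.+1 => c) = c.
Proof.
by rewrite /mean sumr_const card_ord -[c *+ _]scaler_nat scalerA mulVf ?scale1r// pnatr_eq0.
Qed.

Lemma meanD n (x y : 'I_n.+1 -> E) : mean (fun i => x i + y i) = mean x + mean y.
Proof. by rewrite /mean big_split scalerDr. Qed.

Lemma meanN n (x : 'I_n.+1 -> E) : mean (fun i => - x i) = - mean x.
Proof. by rewrite /mean sumrN scalerN. Qed.

Lemma mean_inj n (s : 'I_n.+1 -> 'I_n.+1) (x : 'I_n.+1 -> E) :
  injective s -> mean (fun i => x (s i)) = mean x.
Proof. by move=> si; rewrite /mean [in RHS](reindex_inj si). Qed.

Lemma norm_mean n (x : 'I_n.+1 -> E) b : (forall i, `|x i| <= b) -> `|mean x| <= b.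
Proof.
move=> xb; rewrite /mean normrZ ger0_norm ?invr_ge0// ler_pdivrMl ?ltr0n//.
apply: le_trans (ler_norm_sum _ _ _) _.
by apply: le_trans (ler_sum _ (fun i _ => xb i)) _; rewrite sumr_const card_ord mulr_natl.
Qed.

Lemma norm_meanB n (x y : 'I_n.+1 -> E) b :
  (forall i, `|x i - y i| <= b) -> `|mean x - mean y| <= b.
Proof. by move=> xb; rewrite -meanN -meanD; exact: norm_mean. Qed.

End Mean.

Section LogChart.
Variables (R : realType) (U : topGroupType) (E : completeNormedModType R).

(* [ci] is the inverse of a chart at the identity, translated so that the
   identity gets coordinate [0] and dilated until the estimates hold on balls
   of fixed radius.  No inverse to [ci] is needed. *)
Record log_chart (ci : E -> U) : Prop := LogChart {
  lc0 : ci 0 = 1%g ;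
  lc_inj : forall x y, `|x| <= 4 -> `|y| <= 4 -> ci x = ci y -> x = y ;
  lc_mul : forall x y, `|x| <= 1 -> `|y| <= 1 ->
    exists2 z, (ci x * ci y)%g = ci z & `|z - (x + y)| <= `|x| * `|y| / 8 ;
  lc_divl : forall x y, `|x| <= 1 -> `|y| <= 1 ->
    exists2 v, ci y = (ci x * ci v)%g & `|v| <= 2 * `|y - x| ;
  lc_divr : forall x y, `|x| <= 1 -> `|y| <= 1 ->
    exists2 v, ci y = (ci v * ci x)%g & `|v| <= 2 * `|y - x| ;
  lc_nbhs : forall A : set U, nbhs (1%g : U) A <->
    exists2 a : R, 0 < a & forall x, `|x| <= a -> A (ci x)
}.

Variables (ci : E -> U) (Hc : log_chart ci).
Implicit Types (x y z v w : E) (g h u : U) (a b e K : R).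

(** [lc_mul] only provides some coordinate of the product; injectivity on the ball of radius 4 makes
    the estimate hold for any given one. *)
Lemma mul_coord x y z : `|x| <= 1 -> `|y| <= 1 -> `|z| <= 4 ->
  (ci x * ci y)%g = ci z -> `|z - (x + y)| <= `|x| * `|y| / 8.
Proof.
move=> x1 y1 z4 xyz; have [z' xyz' z'b] := lc_mul Hc x1 y1.
suff -> : z = z' by [].
apply: (lc_inj Hc) => //; last by rewrite -xyz -xyz'.
have := ler_normD (z' - (x + y)) (x + y); rewrite subrK.
have := ler_normD x y; have := normr_ge0 x; have := normr_ge0 y; nra.
Qed.

(** Approximate coordinates, with an error [e] and a size [b]. The size is carried along because
    each product adds an error bounded by the product of the sizes, so long words are estimated
    without explicit remainders. *)
Definition apx e b x u := exists x', [/\ u = ci x', `|x' - x| <= e & `|x'| <= b].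

Lemma apx_exact x b : `|x| <= b -> apx 0 b x (ci x).
Proof. by move=> xb; exists x; rewrite subrr normr0. Qed.

Lemma apx_mul e b e' b' x y u u' : b <= 1 -> b' <= 1 ->
  apx e b x u -> apx e' b' y u' ->
  apx (e + e' + b * b') (b + b' + b * b') (x + y) (u * u')%g.
Proof.
move=> b1 b1' [x' [-> xe xb]] [y' [-> ye yb]].
have [z xyz zb] := lc_mul Hc (le_trans xb b1) (le_trans yb b1').
have xybb : `|x'| * `|y'| <= b * b' by apply: ler_pM.
have xy0 : 0 <= `|x'| * `|y'| by apply: mulr_ge0.
exists z; split => //.
  have -> : z - (x + y) = (z - (x' + y')) + ((x' - x) + (y' - y)).
    by rewrite [x' - x + _]addrACA -opprD addrA subrK.
  apply: le_trans (ler_normD _ _) _; have := ler_normD (x' - x) (y' - y); lra.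
have := ler_normD (z - (x' + y')) (x' + y'); rewrite subrK.
have := ler_normD x' y'; lra.
Qed.

Lemma apx_inv e b x u : b <= 1 / 2 ->
  apx e b x u -> apx (e + b * b) (2 * b) (- x) (u^-1)%g.
Proof.
move=> b1 [x' [-> xe xb]].
have x1 : `|x'| <= 1 by lra.
have [|v xv vb] := lc_divl Hc x1 (y := 0); first by rewrite normr0.
rewrite sub0r normrN in vb; rewrite (lc0 Hc) in xv.
have -> : ((ci x')^-1)%g = ci v by apply: (mulgI (ci x')); rewrite mulgV.
have v1 : `|v| <= 1 by lra.
have := mul_coord x1 v1 _ (esym (etrans (lc0 Hc) xv)).
rewrite normr0 sub0r normrN => /(_ (ler0n _ _)) xvb.
exists v; split => //; last by lra.
have -> : v - - x = (x' + v) - (x' - x).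
  by rewrite opprK opprB [x' + v]addrC -addrA [x' + _]addrC subrK.
apply: le_trans (ler_normB _ _) _.
have : `|x'| * `|v| <= b * (2 * b) by apply: ler_pM => //; lra.
have : 0 <= b * b by rewrite mulr_ge0// (le_trans _ xb).
lra.
Qed.

Lemma apx_uniq e b e' b' x y u : b <= 4 -> b' <= 4 ->
  apx e b x u -> apx e' b' y u -> `|x - y| <= e + e'.
Proof.
move=> b4 b4' [x' [-> xe xb]] [y' [xy ye yb]].
have exy : x' = y' by apply: (lc_inj Hc) xy; lra.
apply: le_trans (ler_distD x' _ _) _; apply: lerD; first by rewrite distrC.
by rewrite exy.
Qed.

(** Partial products stay within [2 j a] of [0], so the next factor adds an error of order
    [j a * a], at most [a * (n a)]. The induction therefore carries a bound linear in [j], and the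
    total depends on [n * a] only. *)
Lemma prod_coord n (f : nat -> E) a : (forall i, (i < n)%N -> `|f i| <= a) ->
  n%:R * a <= 1 / 2 -> 0 <= a ->
  exists2 z, (\prod_(i < n) ci (f i))%g = ci z &
    `|z - \sum_(i < n) f i| <= (n%:R * a) * (n%:R * a).
Proof.
move=> fa na a0.
suff : forall j, (j <= n)%N -> exists2 z, (\prod_(i < j) ci (f i))%g = ci z &
    `|z - \sum_(i < j) f i| <= (j%:R * a) * (n%:R * a) /\ `|\sum_(i < j) f i| <= j%:R * a.
  by case/(_ n (leqnn n)) => z zE [zb _]; exists z.
elim=> [_|j IH jn].
  by exists 0; rewrite !big_ord0 ?(lc0 Hc)// subrr normr0 !mul0r.
have [z zE [zb sb]] := IH (ltnW jn).
have fj := fa j jn.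
have jna : (j%:R + 1) * a <= n%:R * a.
  by rewrite ler_wpM2r// natr1 ler_nat.
have j0 : (0 : R) <= j%:R * a by rewrite mulr_ge0.
have z1 : `|z| <= 2 * (j%:R * a).
  have := ler_normD (z - \sum_(i < j) f i) (\sum_(i < j) f i); rewrite subrK.
  by nra.
have [||z' zz' z'b] := lc_mul Hc (x := z) (y := f j); [lra|lra|].
exists z'; first by rewrite big_ord_recr /= zE.
rewrite big_ord_recr /= -natr1; split; last first.
  by apply: le_trans (ler_normD _ _) _; lra.
have -> : z' - (\sum_(i < j) f i + f j) = (z' - (z + f j)) + (z - \sum_(i < j) f i).
  by rewrite !opprD -[RHS]addrA; congr (_ + _); rewrite [RHS]addrACA addNr add0r addrC.
apply: le_trans (ler_normD _ _) _.
have : `|z| * `|f j| <= 2 * (j%:R * a) * a by apply: ler_pM.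
nra.
Qed.

Lemma conj_prod n (f : nat -> U) g :
  (g * (\prod_(i < n) f i) * g^-1)%g = (\prod_(i < n) (g * f i * g^-1))%g.
Proof.
elim: n => [|n IH]; first by rewrite !big_ord0 mulg1 mulgV.
by rewrite !big_ord_recr /= -IH !mulgA mulgVK.
Qed.

(** The ball on which the estimate holds is determined by [K], so one [K] for many [g] means
    uniformity in both constant and radius; the condition also keeps the conjugate in the unit
    ball. *)
Definition conj_lip K g :=
  forall x, K * `|x| <= 1 -> exists2 y, (g * ci x * g^-1)%g = ci y & `|y| <= K * `|x|.

(* [ci x] is a product of [n] elements with coordinates at most [2|x|/n], which
   for large [n] lie in the ball where conjugation by [g] is controlled; the
   radius [r] of this ball has disappeared from the conclusion. *)
Lemma conj_lip_local M g r : 0 <= M -> 0 < r ->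
  (forall x, `|x| <= r -> exists2 y, (g * ci x * g^-1)%g = ci y & `|y| <= M * `|x|) ->
  conj_lip (8 * (M + 1)) g.
Proof.
move=> M0 r0 gM x xK.
have x0 := normr_ge0 x.
have Mx0 : 0 <= M * `|x| by apply: mulr_ge0.
have [N Nr] : exists N : nat, 2 * `|x| / r <= N.+1%:R.
  exists (Num.truncn (2 * `|x| / r)).
  by rewrite ltW// truncnS_gt// mulr_ge0 ?invr_ge0 ?mulr_ge0// ltW.
set n := N.+1 in Nr.
have n0 : 0 < n%:R :> R by rewrite ltr0n.
pose p k : E := (k%:R / n%:R) *: x.
have p1 k : (k <= n)%N -> `|p k| <= 1.
  move=> kn; rewrite normrZ ger0_norm; last by rewrite divr_ge0.
  have : k%:R / n%:R <= 1 :> R by rewrite ler_pdivrMr// mul1r ler_nat.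
  have : 0 <= k%:R / n%:R :> R by rewrite divr_ge0.
  nra.
have pB k : `|p k.+1 - p k| = `|x| / n%:R.
  by rewrite -scalerBl -mulrBl -natr1 [_ + 1]addrC addrK mul1r normrZ ger0_norm ?invr_ge0// mulrC.
have /choice [v vP] : forall k, exists v, (k < n)%N ->
    ci (p k.+1) = (ci (p k) * ci v)%g /\ `|v| <= 2 * `|x| / n%:R.
  move=> k; have [kn|_] := boolP (k < n)%N; last by exists 0.
  have [v vE vb] := lc_divl Hc (p1 k (ltnW kn)) (p1 k.+1 kn).
  by exists v => _; split => //; rewrite -mulrA -(pB k).
have vr k : (k < n)%N -> `|v k| <= r.
  move=> /vP [_ vk]; apply: le_trans vk _.
  by rewrite ler_pdivrMr// [r * _]mulrC -ler_pdivrMr.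
have /choice [y yP] : forall k, exists y, (k < n)%N ->
    (g * ci (v k) * g^-1)%g = ci y /\ `|y| <= M * (2 * `|x| / n%:R).
  move=> k; have [kn|_] := boolP (k < n)%N; last by exists 0.
  have [y yE yb] := gM _ (vr k kn); exists y => _; split => //.
  by apply: le_trans yb _; rewrite ler_wpM2l//; case: (vP k kn).
(* The total size of the conjugated pieces does not depend on [n]. The factor 8 makes it small
   enough for [prod_coord], and the summand 1 in [M + 1] keeps [x] in the unit ball. *)
have na : n%:R * (M * (2 * `|x| / n%:R)) = 2 * (M * `|x|).
  by field; rewrite pnatr_eq0.
have [|||z zE zb] := @prod_coord n y (M * (2 * `|x| / n%:R)).
- by move=> i /yP [].
- by rewrite na; lra.
- by rewrite mulr_ge0// divr_ge0// mulr_ge0.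
exists z.
  rewrite -zE (eq_bigr (fun i : 'I_n => g * ci (v i) * g^-1)%g).
    rewrite -(conj_prod n (fun i => ci (v i))); congr (_ * _ * _)%g.
    have -> : x = p n by rewrite /p divff ?scale1r// pnatr_eq0.
    suff : forall j, (j <= n)%N -> ci (p j) = (\prod_(i < j) ci (v i))%g by exact.
    elim=> [_|j IH jn]; first by rewrite big_ord0 /p mul0r scale0r (lc0 Hc).
    by rewrite big_ord_recr /= -IH ?(ltnW jn)//; case: (vP j jn).
  by move=> i _; case: (yP i (ltn_ord i)).
have sb : `|\sum_(i < n) y i| <= 2 * (M * `|x|).
  apply: le_trans (ler_norm_sum _ _ _) _.
  apply: (@le_trans _ _ (\sum_(i < n) (M * (2 * `|x| / n%:R)))).
    by apply: ler_sum => i _; case: (yP i (ltn_ord i)).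
  by rewrite sumr_const card_ord -[_ *+ n]mulr_natl na.
have := ler_normD (z - \sum_(i < n) y i) (\sum_(i < n) y i); rewrite subrK.
move: zb; rewrite na; nra.
Qed.

Lemma conj_lipM K L g h : 1 <= K -> 1 <= L -> conj_lip K g -> conj_lip L h ->
  conj_lip (K * L) (g * h)%g.
Proof.
move=> K1 L1 gK hL x KLx.
have x0 := normr_ge0 x.
have [|y yE yb] := hL x; first by nra.
have [|z zE zb] := gK y; first by nra.
exists z; last by nra.
by rewrite -zE -yE invgM !mulgA.
Qed.

(** The product [ci w * ci x] has a coordinate within [2 |x|] of [w], and dividing it on the right
    by [ci w] at most doubles this distance. *)
Lemma conj_lip_small w : `|w| <= 1 / 2 -> conj_lip 4 (ci w).
Proof.
move=> w2 x x4; have x0 := normr_ge0 x; have w0 := normr_ge0 w.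
have [||b bE bb] := lc_mul Hc (x := w) (y := x); [lra|lra|].
have bw : `|b - w| <= 2 * `|x|.
  have -> : b - w = (b - (w + x)) + x by rewrite opprD addrA subrK.
  apply: le_trans (ler_normD _ _) _; nra.
have b1 : `|b| <= 1 by have := ler_normD (b - w) w; rewrite subrK; lra.
have [|v vE vb] := lc_divr Hc _ b1 (x := w); first by lra.
by exists v; [rewrite bE vE mulgK|lra].
Qed.

(** Upgrades [conj_lip], an estimate at the origin, to an estimate between two points: in
    [ci x' = ci x * ci v] only the small factor [ci v] has to be conjugated. *)
Lemma conj_close K g x x' y y' : conj_lip K g ->
  `|x| <= 1 -> `|x'| <= 1 -> `|y| <= 1 -> `|y'| <= 4 -> 2 * K * `|x' - x| <= 1 -> 0 <= K ->
  (g * ci x * g^-1)%g = ci y -> (g * ci x' * g^-1)%g = ci y' ->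
  `|y' - y| <= 4 * K * `|x' - x|.
Proof.
move=> gK x1 x1' y1 y4 xx K0 xy xy'.
have [v vE vb] := lc_divl Hc x1 x1'.
have v0 := normr_ge0 v; have [|w wE wb] := gK v; first by nra.
have d0 := normr_ge0 (x' - x).
have wB : `|w| <= 2 * K * `|x' - x| by nra.
have ww : (ci y * ci w)%g = ci y'.
  by rewrite -xy -wE -xy' vE !mulgA mulgVK.
have := mul_coord y1 (le_trans wB xx) y4 ww.
have -> : y' - y = (y' - (y + w)) + w by rewrite opprD addrA subrK.
have := ler_normD (y' - (y + w)) w.
have : `|y| * `|w| <= 1 * `|w| by rewrite ler_wpM2r.
have := normr_ge0 w.
lra.
Qed.

(* Conjugation by [g] is additive up to second order, hence commutes with
   averages up to second order, uniformly in [g]. *)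
Lemma conj_mean K g n (x y : 'I_n.+1 -> E) b w : conj_lip K g -> 1 <= K ->
  K * b <= 1 / 8 -> (forall i, `|x i| <= b) ->
  (forall i, (g * ci (x i) * g^-1)%g = ci (y i)) -> (forall i, `|y i| <= K * b) ->
  (g * ci (mean x) * g^-1)%g = ci w -> `|w| <= K * b ->
  `|w - mean y| <= 10 * (K * b) * (K * b).
Proof.
move=> gK K1 Kb xb xy yb mw wb.
have b0 : 0 <= b by apply: le_trans (xb ord0).
have b8 : b <= 1 / 8 by nra.
have KbK : b * (K * b) <= (K * b) * (K * b) by apply: ler_wpM2r; nra.
set N := n.+1; have N0 : 0 < N%:R :> R by rewrite ltr0n.
(* The pieces [ci (s i)] link both sides: the [N]-th power of one of them is nearly [ci (x i)], and
   the product of all of them is nearly [ci (mean x)]. With [u i] the coordinate of the conjugate of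
   [ci (s i)], this makes [N *: u i] close to [y i] and [\sum_i u i] close to [w]. *)
pose s i : E := N%:R^-1 *: x i.
have sb i : `|s i| <= b / N%:R.
  by rewrite /s normrZ ger0_norm ?invr_ge0// mulrC ler_wpM2r ?invr_ge0.
have N1 : 1 <= N%:R :> R by rewrite ler1n.
have Kb0 : 0 <= K * b by rewrite mulr_ge0//; lra.
have KbN : K * b / N%:R <= 1.
  by rewrite ler_pdivrMr// mul1r (le_trans _ N1)//; lra.
have /choice [u uP] : forall i, exists u : E, (g * ci (s i) * g^-1)%g = ci u /\
    `|u| <= K * b / N%:R.
  move=> i; have [|u uE ub] := gK (s i).
    by apply: le_trans KbN; rewrite -mulrA ler_wpM2l//; lra.
  exists u; split => //; apply: le_trans ub _.
  by rewrite -mulrA ler_wpM2l//; lra.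
have NB (c : R) : N%:R * (c / N%:R) = c by rewrite mulrC divfK// gt_eqF.
have close z q x0 y0 : (g * ci z * g^-1)%g = ci q -> (g * ci x0 * g^-1)%g = ci y0 ->
    `|x0| <= b -> `|y0| <= K * b -> `|z - x0| <= b * b -> `|q| <= 4 ->
    `|q - y0| <= 4 * (K * b) * (K * b).
  move=> zq xy0 x0b y0b zx q4.
  have z1 : `|z| <= 1 by have := ler_normD (z - x0) x0; rewrite subrK; nra.
  have zx0 := normr_ge0 (z - x0).
  have := @conj_close K g x0 z y0 q gK _ z1 _ q4 _ _ xy0 zq.
  have KKb : K * (b * b) <= (K * b) * (K * b) by nra.
  have : K * `|z - x0| <= K * (b * b) by apply: ler_wpM2l => //; lra.
  move=> h1 h2; apply: le_trans (h2 _ _ _ _) _; nra.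
have q4 (q S : E) : `|q - S| <= K * b * (K * b) -> `|S| <= K * b -> `|q| <= 4.
  by move=> h1 h2; have := ler_normD (q - S) S; rewrite subrK; nra.
have ubn i : `|N%:R *: u i - y i| <= 5 * (K * b) * (K * b).
  have sumN (f : E) : \sum_(k < N) f = N%:R *: f by rewrite sumr_const card_ord scaler_nat.
  have [|||z zE] := @prod_coord N (fun=> s i) (b / N%:R); rewrite ?NB//; [lra|by rewrite divr_ge0|].
  rewrite sumN scalerA divff ?gt_eqF// scale1r => zb.
  have [_ ui] := uP i.
  have [|||q qE] := @prod_coord N (fun=> u i) (K * b / N%:R); rewrite ?NB//;
    [lra|by rewrite divr_ge0//; nra|].
  rewrite sumN => qb.
  have zq : (g * ci z * g^-1)%g = ci q.
    by rewrite -zE (conj_prod N (fun=> ci (s i))) -qE; apply: eq_bigr => k _; case: (uP i).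
  have := close _ _ _ _ zq (xy i) (xb i) (yb i) zb.
  have Nu : `|N%:R *: u i| <= K * b.
    by rewrite normrZ ger0_norm// -[leRHS]NB ler_wpM2l.
  move=> /(_ (q4 _ _ qb Nu)) => h.
  apply: le_trans (ler_distD q _ _) _; rewrite distrC; lra.
pose ext (f : 'I_N -> E) (k : nat) := f (inord k).
have [|||z zE] := @prod_coord N (ext s) (b / N%:R); rewrite ?NB//;
  [by move=> i _; exact: sb|lra|by rewrite divr_ge0|].
have extE (f : 'I_N -> E) : \sum_(i < N) ext f i = \sum_i f i.
  by apply: eq_bigr => i _; rewrite /ext inord_val.
rewrite extE -scaler_sumr -/(mean x) => zb.
have [|||q qE] := @prod_coord N (ext u) (K * b / N%:R); rewrite ?NB//.
- by move=> i _; case: (uP (inord i)).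
- lra.
- by rewrite divr_ge0//; nra.
rewrite extE => qb.
have zq : (g * ci z * g^-1)%g = ci q.
  by rewrite -zE (conj_prod N (fun k => ci (ext s k))) -qE; apply: eq_bigr => k _;
     case: (uP (inord k)).
have su : `|\sum_i u i| <= K * b.
  apply: le_trans (ler_norm_sum _ _ _) _.
  apply: (@le_trans _ _ (\sum_(i < N) (K * b / N%:R))).
    by apply: ler_sum => i _; case: (uP i).
  by rewrite sumr_const card_ord -[_ *+ _]mulr_natl NB.
have h1 := close _ _ _ _ zq mw (norm_mean xb) wb zb (q4 _ _ qb su).
have h2 : `|\sum_i u i - mean y| <= 5 * (K * b) * (K * b).
  have -> : \sum_i u i = mean (fun i => N%:R *: u i).
    by rewrite /mean -scaler_sumr scalerA mulVf ?scale1r// gt_eqF.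
  exact: norm_meanB.
apply: le_trans (ler_distD q _ _) _; rewrite distrC.
have := ler_distD (\sum_i u i) q (mean y); lra.
Qed.

End LogChart.

(** * Newton iteration *)

Lemma half_pow_small (R : realType) (c e : R) : 0 < e ->
  exists N, forall n, (N <= n)%N -> c / 2 ^+ n <= e.
Proof.
move=> e0; have [c0|c0] := leP c 0.
  by exists 0%N => n _; apply: le_trans (ltW e0); rewrite mulr_le0_ge0// invr_ge0 exprn_ge0.
exists (Num.truncn (c / e)).+1 => n Nn.
rewrite ler_pdivrMr ?exprn_gt0// mulrC -ler_pdivrMr//.
apply: le_trans (ltW (truncnS_gt _)) _.
by rewrite -natrX ler_nat; apply: leq_trans Nn _; rewrite ltnW// ltn_expl.
Qed.

Lemma geometric_cauchy_cvg (R : realType) (E : completeNormedModType R) (u : nat -> E) (c : R) :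
  0 <= c -> (forall n, `|u n.+1 - u n| <= c / 2 ^+ n) ->
  exists2 l, u @ \oo --> l & forall n, `|l - u n| <= 2 * c / 2 ^+ n.
Proof.
move=> c0 uc.
have p2 n : 0 < 2 ^+ n :> R by rewrite exprn_gt0.
have uk n k : `|u (n + k)%N - u n| <= 2 * c / 2 ^+ n - 2 * c / 2 ^+ (n + k).
  elim: k => [|k IH]; first by rewrite addn0 !subrr normr0.
  rewrite addnS; apply: le_trans (ler_distD (u (n + k)%N) _ _) _.
  have := uc (n + k)%N; have -> : 2 * c / 2 ^+ (n + k).+1 = c / 2 ^+ (n + k).
    by rewrite exprS invfM mulrACA divff ?mul1r.
  lra.
have uk' n m : (n <= m)%N -> `|u m - u n| <= 2 * c / 2 ^+ n.
  move=> /subnKC <-; apply: le_trans (uk _ _) _; rewrite lerBlDr lerDl.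
  by rewrite divr_ge0 ?mulr_ge0// ltW.
have ucvg : cvg (u @ \oo).
  apply: cauchy_cvg; apply: cauchy_exP => e e0.
  have [N NP] := @half_pow_small _ (2 * c) (e / 2) ltac:(by rewrite divr_gt0).
  exists (u N), N => // m /= Nm; rewrite -ball_normE /= distrC.
  apply: le_lt_trans (uk' _ _ Nm) _; apply: le_lt_trans (NP N _) _ => //.
  by rewrite ltr_pdivrMr// ltr_pMr// ltr1n.
exists (lim (u @ \oo)) => // n.
apply: (@closed_cvg _ _ \oo _ u (fun z => `|z - u n| <= 2 * c / 2 ^+ n)) => //.
  rewrite (_ : (fun z => _) = closed_ball_ Num.norm (u n) (2 * c / 2 ^+ n)).
    exact: closed_closed_ball_.
  by apply: funext => z; rewrite /closed_ball_ /= distrC.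
by exists n => // m /= /uk'.
Qed.

(** Common scheme of both parts: [I] is the group when a map is corrected, and [unit] when a single
    conjugating vector is sought. A step may assume that the iterate is within [2 c] of the start,
    which keeps the Lipschitz constant fixed; the last clause is uniform in [i], so continuity
    passes to the limit. *)
Lemma geometric_iteration (R : realType) (E : completeNormedModType R) (I : Type)
    (P : nat -> (I -> E) -> Prop) (w0 : I -> E) (c : R) : 0 <= c -> P 0%N w0 ->
  (forall n w, P n w -> (forall i, `|w i - w0 i| <= 2 * c) ->
    exists2 w', P n.+1 w' & forall i, `|w' i - w i| <= c / 2 ^+ n) ->
  exists (w_ : nat -> I -> E) (w : I -> E), [/\ forall n, P n (w_ n),
     forall n i, `|w_ n i - w0 i| <= 2 * c,
     forall i, w_ ^~ i @ \oo --> w i,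
     forall i, `|w i - w0 i| <= 2 * c &
     forall n i, `|w i - w_ n i| <= 2 * c / 2 ^+ n].
Proof.
move=> c0 P0 step.
have p2 n : 0 < 2 ^+ n :> R by rewrite exprn_gt0.
have /choice [f fP] : forall nw : nat * (I -> E), exists w', P nw.1 nw.2 ->
    (forall i, `|nw.2 i - w0 i| <= 2 * c) ->
    P nw.1.+1 w' /\ forall i, `|w' i - nw.2 i| <= c / 2 ^+ nw.1.
  case=> n w /=; have [Pw|Pw] := pselect (P n w); last by exists w.
  have [wc|wc] := pselect (forall i, `|w i - w0 i| <= 2 * c); last by exists w.
  by have [w' ? ?] := step n w Pw wc; exists w'.
pose w_ := fix w_ n := if n is k.+1 then f (k, w_ k) else w0.
(* Subtracting the tail of the geometric series makes the bound inductive. *)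
have inv n : P n (w_ n) /\ forall i, `|w_ n i - w0 i| <= 2 * c - 2 * c / 2 ^+ n.
  elim: n => [|n [IHP IHw]].
    by split => // i; rewrite /= expr0 divr1 !subrr normr0.
  have wc i : `|w_ n i - w0 i| <= 2 * c.
    by apply: le_trans (IHw i) _; rewrite lerBlDr lerDl divr_ge0 ?mulr_ge0// ltW.
  have [Pf fw] := fP (n, w_ n) IHP wc; split => //= i.
  apply: le_trans (ler_distD (w_ n i) _ _) _.
  have := fw i; have := IHw i; rewrite /=.
  have -> : 2 * c / 2 ^+ n.+1 = c / 2 ^+ n.
    by rewrite exprS invfM mulrACA divff ?mul1r.
  have : 2 * c / 2 ^+ n = c / 2 ^+ n + c / 2 ^+ n by rewrite -mulrA mulr_natl mulr2n.
  lra.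
have wc n i : `|w_ n i - w0 i| <= 2 * c.
  by apply: le_trans ((inv n).2 i) _; rewrite lerBlDr lerDl divr_ge0 ?mulr_ge0// ltW.
have /choice [w wP] : forall i, exists l, w_ ^~ i @ \oo --> l /\
    forall n, `|l - w_ n i| <= 2 * c / 2 ^+ n.
  move=> i; have [|l ? ?] := @geometric_cauchy_cvg R E (w_ ^~ i) c c0; last by exists l.
  by move=> n; have [_] := fP (n, w_ n) (inv n).1 (wc n); exact.
exists w_, w; split => //.
- by move=> n; case: (inv n).
- by move=> i; case: (wP i).
- by move=> i; have [_ /(_ 0%N)] := wP i; rewrite expr0 divr1.
- by move=> n i; case: (wP i).
Qed.

(** The increment [w] is on the right, to fit the quotients [(u * t i)^-1 * t (s i)] of
    [averaging_net]. *)
Lemma compact_uniform_continuity (K U : topGroupType) (f : K -> U) (A : set U) :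
  compact [set: K] -> continuous f -> nbhs (1%g : U) A ->
  exists2 W : set K, nbhs (1%g : K) W &
    forall t w, W w -> A ((f t)^-1 * f (t * w))%g.
Proof.
move=> /compact_near_coveringP /(_ _ (nbhs (1%g : K)) (fun w t => A ((f t)^-1 * f (t * w))%g)).
move=> /(_ (nbhs_filter (1%g : K))) KP fc nA.
exists [set w | [set: K] `<=` fun t => A ((f t)^-1 * f (t * w))%g]; last first.
  by move=> t w; apply.
apply: KP => t _.
have : (fun p : K * K => (f p.1)^-1 * f (p.1 * p.2))%g @ (t, 1%g) --> ((f t)^-1 * f (t * 1))%g.
  apply: cvg_mulg.
    by apply: cvg_invg; apply: (cvg_comp _ _ (@cvg_fst _ _ (nbhs t) (nbhs (1%g : K)) _)); exact: fc.
  apply: (@cvg_comp _ _ _ (fun p : K * K => p.1 * p.2)%g f _ (nbhs (t * 1)%g)); last exact: fc.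
  exact: (mulg_continuous (t, 1%g)).
by rewrite mulg1 mulVg; apply.
Qed.

Section LogTopology.
Variables (R : realType) (U : topGroupType) (E : completeNormedModType R).
Variables (ci : E -> U) (Hc : log_chart ci).

Lemma nbhs_mull (x : U) (A : set U) : nbhs x A -> nbhs (1%g : U) [set u | A (x * u)%g].
Proof.
rewrite -{1}[x]mulg1; case/nbhs_mulg => B [C [/nbhs_singleton Bx nC BC]].
by apply: filterS nC => u /(BC _ _ Bx).
Qed.

Lemma log_ball_nbhs (a : R) : 0 < a -> nbhs (1%g : U) [set ci v | v in [set v : E | `|v| <= a]].
Proof. by move=> a0; apply/(lc_nbhs Hc); exists a => // x xa; exists x. Qed.

(** Continuity of [ci] on the unit ball is not a field of [log_chart]; it is recovered from
    [lc_divl] and the description of the neighbourhoods of the identity. *)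
Lemma cvg_log_inv (T : Type) (F : set_system T) {FF : Filter F} (m : T -> E) (l : E) :
  m @ F --> l -> (forall t, `|m t| <= 1) -> `|l| <= 1 -> (ci \o m) @ F --> ci l.
Proof.
move=> ml m1 l1 A /nbhs_mull /(lc_nbhs Hc) [a a0 aA].
have a2 : 0 < a / 2 by rewrite divr_gt0.
have /cvgrPdist_le /(_ _ a2) := ml.
apply: filterS => t mt /=; have [v -> vb] := lc_divl Hc l1 (m1 t).
by apply: aA; rewrite distrC in mt; lra.
Qed.

(** Plays the role of continuity of the chart: coordinates picked pointwise by choice are unique in
    a small ball, hence vary continuously. *)
Lemma log_continuous (T : topologicalType) (h : T -> U) (x : T -> E) :
  continuous h -> (forall t, h t = ci (x t)) -> (forall t, `|x t| <= 1 / 2) -> continuous x.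
Proof.
move=> hc hx xb t; apply/cvgrPdist_le => e e0.
set a := Num.min (e / 2) 1.
have a0 : 0 < a by rewrite lt_min divr_gt0// ltr01.
have : (fun s => (h t)^-1 * h s)%g @ t --> ((h t)^-1 * h t)%g.
  by apply: cvg_mulg; [exact: cvg_cst|exact: hc].
rewrite mulVg => hV; have hB : \forall s \near t,
    [set ci v | v in [set v : E | `|v| <= a]] ((h t)^-1 * h s)%g.
  exact: (hV _ (log_ball_nbhs a0)).
apply: filterS hB => s /= [v va vE].
have := va; rewrite le_min => /andP [ve v1].
have := xb t; have := xb s => xs xt.
have st : (ci (x t) * ci v)%g = ci (x s) by rewrite vE -!hx mulgA mulgV mul1g.
have := @mul_coord _ _ _ _ Hc (x t) v (x s) ltac:(lra) v1 ltac:(lra) st.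
have := ler_normD (x s - (x t + v)) v.
rewrite opprD addrA subrK distrC.
have : `|x t| * `|v| <= 1 * `|v| by rewrite ler_wpM2r//; lra.
have := normr_ge0 v; lra.
Qed.

(** With the defect placed between [f s] and [f t], correcting [f] on the right only creates
    conjugates by values of [f], never by their inverses. *)
Definition defect_le (K : topGroupType) (d : R) (f : K -> U) :=
  forall s t, exists2 x, ((f s)^-1 * f (s * t) * (f t)^-1)%g = ci x & `|x| <= d.

Lemma mean_continuous (T : topologicalType) n (x : 'I_n.+1 -> T -> E) :
  (forall i, continuous (x i)) -> continuous (fun t => mean (fun i => x i t)).
Proof.
move=> xc t; apply/cvgrPdist_le => e e0.
have : \forall s \near t, forall i, `|x i t - x i s| <= e.
  by apply: filter_forall => i; have /cvgrPdist_le := xc i t; exact.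
by apply: filterS => s xs; exact: norm_meanB.
Qed.

End LogTopology.

Section NewtonStep.
Variables (R : realType) (U : topGroupType) (E : completeNormedModType R).
Variables (ci : E -> U) (Hc : log_chart ci).

(** To first order the defect is a cocycle: [x s s' + s'.x (s s') t = x s (s' t) + s'.x s' t], where
    [s'.] is conjugation by [phi s']. Averaging over [t] turns [x s (s' t)] into [m s], by almost
    invariance of the net, and gives [x s s' = m s + s'.m s' - s'.m (s s')]. This says that the
    first-order defect of [phi * ci m] vanishes. *)
Lemma newton_step (K : topGroupType) (phi : K -> U) (L d : R) :
  compact [set: K] -> continuous phi -> 1 <= L -> 0 < d -> 100 * L * L * d <= 1 ->
  (forall s, conj_lip ci L (phi s)) -> defect_le ci d phi ->
  exists m : K -> E, [/\ continuous m, forall s, `|m s| <= d &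
    defect_le ci (d / 2) (fun s => phi s * ci (m s))%g].
Proof.
move=> Kc phic L1 d0 LLd phiL phid.
have [B BE] : exists B : R, B = L * d by exists (L * d).
have dB : d <= B by rewrite BE ler_peMl// ltW.
have B100 : B <= 1 / 100 by rewrite BE; nra.
have B0 : 0 <= B by rewrite BE; nra.
have BB : B * B <= d / 100.
  have -> : B * B = 100 * L * L * d * d / 100 by rewrite BE; field.
  by rewrite ler_wpM2r// ler_piMl// ltW.
have BBB : B * B <= B / 100 by nra.
have [x xP] : exists x : K -> K -> E, forall s t,
    ((phi s)^-1 * phi (s * t) * (phi t)^-1)%g = ci (x s t) /\ `|x s t| <= d.
  have /choice [x xP] : forall st : K * K, exists x,
      ((phi st.1)^-1 * phi (st.1 * st.2) * (phi st.2)^-1)%g = ci x /\ `|x| <= d.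
    by move=> [s t]; have [x ? ?] := phid s t; exists x.
  by exists (fun s t => x (s, t)) => s t; exact: (xP (s, t)).
have phiM s t : phi (s * t)%g = (phi s * ci (x s t) * phi t)%g.
  by rewrite -(xP s t).1 !mulgA mulgV mul1g mulgVK.
have xd s t : `|x s t| <= d by case: (xP s t).
have conjL s (z : E) : `|z| <= d -> exists2 y, (phi s * ci z * (phi s)^-1)%g = ci y & `|y| <= B.
  move=> zd; have [|y yE yb] := phiL s z.
    by apply: le_trans (_ : B <= 1); [rewrite BE ler_wpM2l//; lra|lra].
  by exists y => //; apply: le_trans yb _; rewrite BE ler_wpM2l//; lra.
(* With this [c], replacing [t] by a point of the net close to it moves [x s t] by at most [d * d]:
   the two increments of [phi] combine to size [4 c], conjugation multiplies by [L], and the product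
   law at most doubles. *)
have [c [c0 cE]] : exists c : R, 0 < c /\ L * (8 * c) = d * d.
  exists (d * d / (8 * L)); split; last by field; lra.
  by rewrite divr_gt0 ?mulr_gt0//; lra.
have d100 : d <= 1 / 100 by lra.
have dd : d * d <= d / 100 by nra.
have c8 : 8 * c <= d * d by rewrite -cE; nra.
have [W nW WP] := compact_uniform_continuity Kc phic (log_ball_nbhs Hc c0).
have xW s t w : W w -> `|x s (t * w)%g - x s t| <= d * d.
  move=> Ww; have [u uc uE] := WP t _ Ww; have [u' uc' uE'] := WP (s * t)%g _ Ww.
  have cc : c * c <= c by nra.
  have au := apx_inv Hc _ (apx_exact ci uc); have au' := apx_exact ci uc'.
  have {au au'} := apx_mul Hc _ _ au' (au _); rewrite add0r.
  move=> /(_ ltac:(nra) ltac:(nra) ltac:(nra)) [z [zE _ zc]].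
  have {}zc : `|z| <= 4 * c by nra.
  have [|z' zE' zb'] := phiL t z; first by nra.
  have {}zb' : `|z'| <= L * (4 * c) by apply: le_trans zb' _; rewrite ler_wpM2l//; lra.
  have xz : (ci (x s t) * ci z')%g = ci (x s (t * w)%g).
    rewrite -zE' -zE uE uE' -(xP s t).1 -(xP s (t * w)%g).1 !invgM !invgK !mulgA.
    by rewrite !(mulgVK, mulgK).
  have xd1 : `|x s t| <= 1 by apply: le_trans (xd s t) _; lra.
  have := @mul_coord _ _ _ _ Hc _ _ _ xd1 _ _ xz.
  have := xd s (t * w)%g; have := xd s t; have := normr_ge0 z'; have := normr_ge0 (x s t).
  move=> h1 h2 h3 h4 /(_ ltac:(nra) ltac:(lra)) h5.
  have -> : x s (t * w)%g - x s t = (x s (t * w)%g - (x s t + z')) + z'.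
    by rewrite opprD addrA subrK.
  apply: le_trans (ler_normD _ _) _.
  have : `|x s t| * `|z'| <= 1 * `|z'| by rewrite ler_wpM2r.
  lra.
have [n [t tP]] := averaging_net Kc nW.
pose m s := mean (fun i => x s (t i)).
have md s : `|m s| <= d by apply: norm_mean => i.
exists m; split => //.
  apply: mean_continuous => i.
  apply: (log_continuous Hc (h := fun s => (phi s)^-1 * phi (s * t i) * (phi (t i))^-1)%g).
  - move=> s; apply: cvg_mulg; last exact: cvg_cst.
    apply: cvg_mulg; first by apply: cvg_invg; exact: phic.
    apply: (cvg_comp _ phi _ (phic (s * t i)%g)).
    by apply: cvg_mulg; [exact: cvg_id|exact: cvg_cst].
  - by move=> s; rewrite (xP s (t i)).1.
  - by move=> s; apply: le_trans (xd _ _) _; lra.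
move=> s s'.
have /choice [p pP] : forall i, exists y,
    (phi s' * ci (x (s * s')%g (t i)) * (phi s')^-1)%g = ci y /\ `|y| <= B.
  by move=> i; have [y ? ?] := conjL s' _ (xd (s * s')%g (t i)); exists y.
have /choice [q qP] : forall i, exists y,
    (phi s' * ci (x s' (t i)) * (phi s')^-1)%g = ci y /\ `|y| <= B.
  by move=> i; have [y ? ?] := conjL s' _ (xd s' (t i)); exists y.
have [P PE PB] := conjL s' _ (md (s * s')%g).
have [Q QE QB] := conjL s' _ (md s').
have Bd : L * d <= 1 / 8 by rewrite -BE; lra.
have Pm : `|P - mean p| <= 10 * B * B.
  rewrite BE; apply: (@conj_mean _ _ _ _ Hc L (phi s') n (fun i => x (s * s')%g (t i)) p d P) => //.
  - by move=> i; case: (pP i).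
  - by move=> i; rewrite -BE; case: (pP i).
  - by rewrite -BE.
have Qm : `|Q - mean q| <= 10 * B * B.
  rewrite BE; apply: (@conj_mean _ _ _ _ Hc L (phi s') n (fun i => x s' (t i)) q d Q) => //.
  - by move=> i; case: (qP i).
  - by move=> i; rewrite -BE; case: (qP i).
  - by rewrite -BE.
have [sg sgi sgP] := tP s'.
have B1 : B <= 1 by lra.
have toB (z : E) : `|z| <= d -> `|z| <= B by move=> zd; apply: le_trans dB.
(* Both sides come from expanding [phi (s * s' * t i)] in two ways. *)
have cocycle i : `|(x s s' + p i) - (x s (t (sg i)) + q i)| <= 3 * (B * B).
  have h1 := apx_mul Hc B1 B1 (apx_exact ci (toB _ (xd s s'))) (apx_exact ci (pP i).2).
  have h2 := apx_mul Hc B1 B1 (apx_exact ci (toB _ (xd s (s' * t i)%g))) (apx_exact ci (qP i).2).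
  have e12 : (ci (x s s') * ci (p i))%g = (ci (x s (s' * t i)%g) * ci (q i))%g.
    rewrite -(pP i).1 -(qP i).1; apply: (mulgI (phi s)); apply: (mulIg (phi s' * phi (t i))%g).
    have l : phi (s * s' * t i)%g =
        (phi s * ci (x s s') * phi s' * ci (x (s * s')%g (t i)) * phi (t i))%g.
      by rewrite (phiM (s * s')%g) (phiM s s').
    have r : phi (s * (s' * t i))%g =
        (phi s * ci (x s (s' * t i)%g) * phi s' * ci (x s' (t i)) * phi (t i))%g.
      by rewrite (phiM s) (phiM s' (t i)) !mulgA.
    by rewrite !mulgA !mulgVK -l -r mulgA.
  rewrite e12 in h1; have := apx_uniq Hc _ _ h1 h2.
  move=> /(_ ltac:(nra) ltac:(nra)) h3.
  have := xW s (s' * t i)%g _ (sgP i); rewrite mulgA mulgV mul1g => h4.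
  have -> : x s s' + p i - (x s (t (sg i)) + q i) =
     (x s s' + p i - (x s (s' * t i)%g + q i)) - (x s (t (sg i)) - x s (s' * t i)%g).
    move: (x s s' + p i) (x s (s' * t i)%g) (x s (t (sg i))) (q i) => A v u r.
    by rewrite opprB !opprD !addrA [_ - r + v]addrAC subrK addrAC.
  have := ler_normB (x s s' + p i - (x s (s' * t i)%g + q i)) (x s (t (sg i)) - x s (s' * t i)%g).
  have : d * d <= B * B by apply: ler_pM => //; lra.
  lra.
have mcoc : `|(x s s' + mean p) - (m s + mean q)| <= 3 * (B * B).
  have -> : m s = mean (fun i => x s (t (sg i))) by rewrite (mean_inj (fun i => x s (t i)) sgi).
  rewrite -[x s s'](@mean_cst _ _ n) -!meanD.
  exact: norm_meanB.
have Bh : B <= 1 / 2 by lra.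
have a1 := apx_inv Hc Bh (apx_exact ci (toB _ (md s))).
have a2 := apx_inv Hc Bh (apx_exact ci QB).
have a3 := apx_mul Hc _ B1 a1 (apx_exact ci (toB _ (xd s s'))).
have a4 := apx_mul Hc B1 _ (apx_exact ci PB) a2.
have := apx_mul Hc _ _ (a3 _) (a4 _).
move=> /(_ ltac:(lra) ltac:(nra) ltac:(lra) ltac:(nra)).
have -> : ((ci (m s))^-1 * ci (x s s') * (ci P * (ci Q)^-1))%g =
   ((phi s * ci (m s))^-1 * (phi (s * s') * ci (m (s * s'))) * (phi s' * ci (m s'))^-1)%g.
  rewrite -PE -QE !invgM invgK phiM !mulgA.
  by rewrite !(mulgVK, mulgK).
case=> y [yE yb _]; exists y => //.
(* [V] is the first-order part of the new defect. Its bound is 3 from the averaged cocycle plus 10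
   for each use of [conj_mean]; adding the remainder of the product keeps the total below
   [50 * (B * B)], hence below [d / 2]. *)
set V := - m s + x s s' + (P - Q) in yb.
have Vb : `|V| <= 23 * (B * B).
  have -> : V = (x s s' + mean p - (m s + mean q)) + ((P - mean p) - (Q - mean q)).
    rewrite /V; move: (x s s') (mean p) (mean q) (m s) => A p' q' M.
    rewrite !opprD opprK [A + p' + _]addrACA [P - p' + _]addrACA [RHS]addrACA.
    by rewrite [- p' + q']addrC -[q' - p']opprB subrr addr0 [A - M]addrC.
  have := ler_normD (x s s' + mean p - (m s + mean q)) ((P - mean p) - (Q - mean q)).
  have := ler_normB (P - mean p) (Q - mean q); lra.
have := ler_normD (y - V) V; rewrite subrK.
nra.
Qed.

End NewtonStep.

Section NewtonLimit.
Variables (R : realType) (U : topGroupType) (E : completeNormedModType R).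
Variables (ci : E -> U) (Hc : log_chart ci) (hU : hausdorff_space U).

(** The iterates are [phi * ci w] with [w] small, so [conj_lip_small] costs a factor 4 once and for
    all. A correction of size [d / 2 ^+ n] moves [w] by at most twice as much, which explains
    [2 * d] in the iteration and [4 * d] in the conclusion. *)
Lemma near_hom_of_defect (K : topGroupType) (phi : K -> U) (L d : R) :
  compact [set: K] -> continuous phi -> 1 <= L -> 0 < d -> 100 * (L * 4) * (L * 4) * d <= 1 ->
  (forall s, conj_lip ci L (phi s)) -> defect_le ci d phi ->
  exists2 psi : K -> U, top_morphism psi &
    forall s, exists2 v, psi s = (phi s * ci v)%g & `|v| <= 4 * d.
Proof.
move=> Kc phic L1 d0 Ld phiL phid.
have dLL : d <= L * L * d by apply: ler_peMl; [exact: ltW|exact: mulr_ege1].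
have d100 : d <= 1 / 100 by lra.
have c0 : 0 <= 2 * d by lra.
pose P n (w : K -> E) := continuous w /\
  defect_le ci (d / 2 ^+ n) (fun s => phi s * ci (w s))%g.
have cwc w : continuous w -> (forall s, `|w s| <= 1) -> continuous (fun s => phi s * ci (w s))%g.
  move=> wc w1 s; apply: cvg_mulg; first exact: phic.
  by apply: (cvg_log_inv Hc); [exact: wc|exact: w1|exact: w1].
have [||w_ [w [w_P w_b w_w wb ww_]]] := @geometric_iteration R E K P (fun=> 0) (2 * d) c0.
- split; first by move=> s; exact: cvg_cst.
  rewrite expr0 divr1; rewrite (_ : (fun s => _) = phi) //.
  by apply/funext => s; rewrite (lc0 Hc) mulg1.
- move=> n w [wc wd] wb; have {}wb s : `|w s| <= 4 * d.
    by have := wb s; rewrite subr0; lra.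
  have p2 : 1 <= 2 ^+ n :> R by rewrite exprn_ege1// ler1n.
  have dn0 : 0 < d / 2 ^+ n by rewrite divr_gt0//; lra.
  have dnd : d / 2 ^+ n <= d by rewrite ler_pdivrMr; [rewrite ler_peMr//|]; lra.
  have L4 : 1 <= L * 4 by lra.
  have w1 s : `|w s| <= 1 by apply: le_trans (wb s) _; lra.
  have [|s|m [mc md mdef]] := newton_step Hc Kc (cwc _ wc w1) L4 dn0 _ _ wd.
  + have : 0 <= L * L * (d - d / 2 ^+ n) by rewrite !mulr_ge0//; lra.
    lra.
  + apply: (conj_lipM L1 _ (phiL s) (conj_lip_small Hc _)); first lra.
    by apply: le_trans (wb s) _; lra.
  have m1 s : `|m s| <= 1 by apply: le_trans (md s) _; lra.
  have /choice [w' w'P] : forall s, exists w', (ci (w s) * ci (m s))%g = ci w' /\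
      `|w' - w s| <= 2 * d / 2 ^+ n.
    move=> s; have [w' ? w'b] := lc_mul Hc (w1 s) (m1 s); exists w'; split => //.
    have -> : w' - w s = (w' - (w s + m s)) + m s by rewrite opprD addrA subrK.
    apply: le_trans (ler_normD _ _) _.
    have : `|w s| * `|m s| <= 1 * `|m s| by rewrite ler_wpM2r.
    have := md s; have := normr_ge0 (m s); lra.
  exists w'; last by move=> s; case: (w'P s).
  split.
    apply: (log_continuous Hc (h := fun s => (ci (w s) * ci (m s))%g)).
    + move=> s; apply: cvg_mulg; apply: (cvg_log_inv Hc);
        [exact: wc|exact: w1|exact: w1|exact: mc|exact: m1|exact: m1].
    + by move=> s; case: (w'P s).
    + move=> s; have := ler_normD (w' s - w s) (w s); rewrite subrK.
      by have [_ ] := w'P s; have := wb s; lra.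
  have -> : d / 2 ^+ n.+1 = d / 2 ^+ n / 2 by rewrite exprSr invfM mulrA.
  rewrite (_ : (fun s => _) = (fun s => phi s * ci (w s) * ci (m s))%g) //.
  by apply/funext => s; rewrite -mulgA (w'P s).1.
have {}wb s : `|w s| <= 4 * d by have := wb s; rewrite subr0; lra.
have w1 s : `|w s| <= 1 by apply: le_trans (wb s) _; lra.
have w_1 n s : `|w_ n s| <= 1 by have := w_b n s; rewrite subr0; lra.
have phi_cvg s : (fun n => phi s * ci (w_ n s))%g @ \oo --> (phi s * ci (w s))%g.
  apply: cvg_mulg; first exact: cvg_cst.
  by apply: (cvg_log_inv Hc); [exact: w_w|move=> n; exact: w_1|exact: w1].
exists (fun s => phi s * ci (w s))%g; last by move=> s; exists (w s).
split.
  apply: cwc => // s; apply/cvgrPdist_le => e e0.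
  have e4 : 0 < e / 4 by rewrite divr_gt0.
  have [N NP] := @half_pow_small _ (2 * (2 * d)) (e / 4) e4.
  have [w_c _] := w_P N; have /cvgrPdist_le /(_ _ e4) := w_c s.
  apply: filterS => t st.
  have := ler_distD (w_ N s) (w s) (w t); have := ler_distD (w_ N t) (w_ N s) (w t).
  have := ww_ N s; have := ww_ N t; rewrite [`|w t - _|]distrC.
  have := NP N (leqnn N); lra.
move=> s t.
(* The defects of the iterates converge both to the defect of the limit and to the identity, so the
   limit is a morphism. *)
pose q (n : nat) := ((phi s * ci (w_ n s))^-1 * (phi (s * t) * ci (w_ n (s * t))) *
  (phi t * ci (w_ n t))^-1)%g.
set r := ((phi s * ci (w s))^-1 * (phi (s * t) * ci (w (s * t))) * (phi t * ci (w t))^-1)%g.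
have h1 : q @ \oo --> r.
  apply: cvg_mulg; last by apply: cvg_invg; exact: phi_cvg.
  by apply: cvg_mulg; [apply: cvg_invg|]; exact: phi_cvg.
have h2 : q @ \oo --> (1%g : U).
  move=> A /(lc_nbhs Hc) [a a0 aA].
  have [N NP] := @half_pow_small _ d a a0; exists N => // n /= Nn.
  have [_ /(_ s t) [x xE xb]] := w_P n.
  by have := aA x (le_trans xb (NP n Nn)); rewrite -xE.
have qE : r = 1%g by exact: (cvg_unique hU h1 h2).
move: qE; rewrite /r.
move: (phi s * ci (w s))%g (phi (s * t) * _)%g (phi t * _)%g => x y z xyz.
by rewrite -[y](mulgVK z) -[(y * z^-1)%g](mulVKg x) [(x^-1 * _)%g]mulgA xyz mulg1.
Qed.

(* The coordinate of an element of [ci y * G] is only defined modulo [F], up to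
   second order; averaging the cocycle identity satisfied by these coordinates
   gives [V] in [F] below. *)
Lemma conj_step (K : topGroupType) (phi : K -> U) (G : set U) (F : set E) (L a : R) :
  compact [set: K] -> top_morphism phi -> is_subgroup G -> closed_subspace F ->
  (forall x, `|x| <= 1 -> (G (ci x) <-> F x)) ->
  1 <= L -> 0 < a -> 200 * L * L * a <= 1 ->
  (forall s, conj_lip ci L (phi s)) ->
  (forall s, exists y g, [/\ phi s = (ci y * g)%g, `|y| <= a & G g]) ->
  exists2 m : E, `|m| <= a &
    forall s, exists y g, [/\ ((ci m)^-1 * phi s * ci m)%g = (ci y * g)%g, `|y| <= a / 2 & G g].
Proof.
move=> Kc [phic phiM] [G1 GM GV] [Fc F0 FD] GF L1 a0 La phiL phiG.
have [B BE] : exists B : R, B = L * a by exists (L * a).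
have aB : a <= B by rewrite BE ler_peMl// ltW.
have B200 : B <= 1 / 200 by rewrite BE; nra.
have B0 : 0 <= B by rewrite BE; nra.
have BB : B * B <= a / 200.
  have -> : B * B = 200 * L * L * a * a / 200 by rewrite BE; field.
  by rewrite ler_wpM2r// ler_piMl// ltW.
have BBB : B * B <= B / 200 by nra.
have conjL s (z : E) : `|z| <= a -> exists2 y, (phi s * ci z * (phi s)^-1)%g = ci y & `|y| <= B.
  move=> zd; have [|y yE yb] := phiL s z.
    by apply: le_trans (_ : B <= 1); [rewrite BE ler_wpM2l//; lra|lra].
  by exists y => //; apply: le_trans yb _; rewrite BE ler_wpM2l//; lra.
have /choice [y /choice [g ygP]] := phiG.
have yE s : phi s = (ci (y s) * g s)%g by case: (ygP s).
have ya s : `|y s| <= a by case: (ygP s).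
have Gg s : G (g s) by case: (ygP s).
have aaL : 0 < a * a / L by rewrite divr_gt0 ?mulr_gt0//; lra.
have phi1 : phi 1%g = 1%g by apply: (mulgI (phi 1%g)); rewrite -phiM !mulg1.
(* As [phi] is a morphism, continuity at the identity is enough; the radius is divided by [L] so
   that all conjugates by values of [phi] are still of second order. *)
have [W nW WP] : exists2 W, nbhs (1%g : K) W & forall t w, W w ->
    exists2 o, (phi t * phi w * (phi t)^-1)%g = ci o & `|o| <= B * B.
  exists (phi @^-1` [set ci v | v in [set v : E | `|v| <= a * a / L]]).
    by apply: phic; rewrite phi1; exact: (log_ball_nbhs Hc aaL).
  move=> t w [v /= vb <-].
  have Lv : L * `|v| <= a * a.
    by apply: le_trans (ler_wpM2l _ vb) _; [lra|rewrite mulrC divfK//; lra].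
  have aBB : a * a <= B * B by apply: ler_pM => //; lra.
  have [|om oE ob] := phiL t v; first lra.
  by exists om => //; lra.
have [n [t tP]] := averaging_net Kc nW.
pose m := mean (fun i => y (t i)).
have ma : `|m| <= a by apply: norm_mean => i.
exists m => // s.
have toB (z : E) : `|z| <= a -> `|z| <= B by move=> za; apply: le_trans aB.
have /choice [p pP] : forall i, exists p,
    (phi s * ci (y (t i)) * (phi s)^-1)%g = ci p /\ `|p| <= B.
  by move=> i; have [p ? ?] := conjL s _ (ya (t i)); exists p.
have [P PE PB] := conjL s _ ma.
have La8 : L * a <= 1 / 8 by rewrite -BE; lra.
have Pm : `|P - mean p| <= 10 * B * B.
  rewrite BE; apply: (@conj_mean _ _ _ _ Hc L (phi s) n (fun i => y (t i)) p a P) => //.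
  - by move=> i; case: (pP i).
  - by move=> i; rewrite -BE; case: (pP i).
  - by rewrite -BE.
have [sg sgi sgP] := tP s.
have B1 : B <= 1 by lra.
have Bh : B <= 1 / 2 by lra.
have /choice [v vP] : forall i, exists v, [/\ F v, `|v| <= 8 * B &
    `|v - (- y (t (sg i)) + (p i + y s))| <= 14 * (B * B)].
  move=> i; have [om oE ob] := WP (s * t i)%g _ (sgP i).
  (* The element [t (sg i)] is nearly [s * t i], and [phi (s * t i)] is expanded with both factors
     split along [G]. Comparison with the splitting of [phi (t (sg i))] puts the word in the [ci]
     factors into [G], hence its coordinate into [F]. *)
  have tE : phi (t (sg i)) = (ci om * ci (p i) * ci (y s) * g s * g (t i))%g.
    have -> : t (sg i) = (s * t i * ((s * t i)^-1 * t (sg i)))%g.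
      by rewrite mulgA mulgV mul1g.
    rewrite phiM -[LHS](mulgVK (phi (s * t i)%g)) oE phiM -(pP i).1.
    by rewrite -!mulgA (mulgA (ci (y s))) -yE mulKg -yE.
  have h1 := apx_inv Hc Bh (apx_exact ci (toB _ (ya (t (sg i))))).
  have h2 := apx_mul Hc B1 B1 (apx_exact ci (pP i).2) (apx_exact ci (toB _ (ya s))).
  have BBb : B * B <= B by lra.
  have h3 : apx ci (B * B) B 0 (ci om).
    by exists om; rewrite subr0; split => //; lra.
  have h4 := apx_mul Hc B1 _ h3 h2.
  have := apx_mul Hc _ _ h1 (h4 _); rewrite !add0r.
  move=> /(_ ltac:(lra) ltac:(nra) ltac:(lra)) [v [vE ve vb]].
  have v8 : `|v| <= 8 * B by nra.
  exists v; split => //; last by nra.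
  apply/GF; first by lra.
  rewrite -vE; have -> : ((ci (y (t (sg i))))^-1 * (ci om * (ci (p i) * ci (y s))))%g =
      (g (t (sg i)) * (g s * g (t i))^-1)%g.
    apply: (mulgI (ci (y (t (sg i))))); apply: (mulIg (g s * g (t i))%g).
    by rewrite mulVKg [X in _ = (X * _)%g]mulgA mulgVK -yE tE !mulgA.
  by apply: (GM _ _ (Gg _)); apply: GV; exact: GM.
pose V := mean v.
have FV : F V.
  have Fsum (I : Type) (r : seq I) (f : I -> E) : (forall i, F (f i)) -> F (\sum_(i <- r) f i).
    move=> Ff; elim: r => [|i r IH]; first by rewrite big_nil.
    by rewrite big_cons -[f i]scale1r; exact: FD.
  rewrite /V /mean -[_ *: _]addr0; apply: FD => //; apply: Fsum => i.
  by case: (vP i).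
have V8 : `|V| <= 8 * B by apply: norm_mean => i; case: (vP i).
have Vb : `|V - (- m + (mean p + y s))| <= 14 * (B * B).
  have -> : m = mean (fun i => y (t (sg i))) by rewrite (mean_inj (fun i => y (t i)) sgi).
  rewrite -[y s](@mean_cst _ _ n) -meanN -!meanD.
  by apply: norm_meanB => i; case: (vP i).
have h1 := apx_inv Hc Bh (apx_exact ci (toB _ ma)).
have h2 := apx_mul Hc B1 B1 (apx_exact ci PB) (apx_exact ci (toB _ (ya s))).
have := apx_mul Hc _ _ h1 h2; rewrite !add0r.
move=> /(_ ltac:(lra) ltac:(nra)) [u [uE ue ub]].
have u1 : `|u| <= 1 by nra.
have uV : `|u - V| <= 32 * (B * B).
  have PE' : P - mean p = - m + (P + y s) - (- m + (mean p + y s)).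
    by rewrite !opprD [RHS]addrACA subrr add0r addrACA subrr addr0.
  rewrite PE' in Pm.
  have := ler_distD (- m + (P + y s)) u V.
  have := ler_distD (- m + (mean p + y s)) (- m + (P + y s)) V.
  rewrite [`|- m + (mean p + y s) - V|]distrC.
  have : B * (B * B) <= B * B by rewrite ler_piMl// mulr_ge0.
  lra.
(* The conjugate of [phi s] is [ci u * g s]. As [V] lies in [F], the factor [ci V] can be moved into
   [G], leaving [ci e] with [|e| <= 2 |u - V| <= 64 * (B * B) <= a / 2]. *)
have [|e eE eb] := lc_divr Hc _ u1 (x := V); first by lra.
exists e, (ci V * g s)%g; split => //.
- by rewrite [RHS]mulgA -eE -uE -PE -!mulgA -yE mulVg mulg1.
- by lra.
- by apply: GM => //; apply/GF => //; lra.
Qed.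
End NewtonLimit.

Section Conjugation.
Variables (R : realType) (U : topGroupType) (E : completeNormedModType R).
Variables (ci : E -> U) (Hc : log_chart ci).

(** A point [h] of the closure satisfies [h * ci v0 = g0] and [h * ci v1 = g1] with [g0], [g1] in
    [G] and [v1] arbitrarily small. The coordinate of [g1^-1 * g0] lies in [F] and tends to [v0], so
    [v0] is in [F] because [F] is closed. *)
Lemma subgroup_closed (G : set U) (F : set E) : is_subgroup G -> closed_subspace F ->
  (forall x, `|x| <= 1 -> (G (ci x) <-> F x)) -> closed G.
Proof.
move=> [G1 GM GV] [Fc F0 FD] GF h hG.
have near_h a : 0 < a -> exists g v, [/\ G g, g = (h * ci v)%g & `|v| <= a].
  move=> a0; have : nbhs h [set x | [set ci v | v in [set v : E | `|v| <= a]] (h^-1 * x)%g].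
    have : (fun x => h^-1 * x)%g @ h --> (h^-1 * h)%g.
      by apply: cvg_mulg; [exact: cvg_cst|exact: cvg_id].
    by rewrite mulVg; apply; exact: (log_ball_nbhs Hc a0).
  case/hG => g [Gg [v va vE]]; exists g, v; split => //.
  by rewrite vE mulgA mulgV mul1g.
have [|g0 [v0 [Gg0 g0E v0b]]] := near_h (1 / 4); first lra.
suff Fv0 : F v0.
  have -> : h = (g0 * (ci v0)^-1)%g by rewrite g0E mulgK.
  by apply: GM => //; apply: GV; apply/GF => //; lra.
apply: Fc => A /nbhs_ballP [e /= e0 eA].
pose r := Num.min (e / 4) (1 / 4).
have [r0 re r4] : [/\ 0 < r, r <= e / 4 & r <= 1 / 4].
  by split; [rewrite lt_min !divr_gt0|rewrite ge_min lexx|rewrite ge_min lexx orbT].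
have [g1 [v1 [Gg1 g1E v1b]]] := near_h r r0.
have v01 : `|v0 - v1| <= 1 / 2 by have := ler_normB v0 v1; lra.
have [||z zE zb] := lc_divl Hc (x := v1) (y := v0); [lra|lra|].
have z1 : `|z| <= 1 by lra.
exists z; split.
  apply/(GF _ z1); have -> : ci z = (g1^-1 * g0)%g.
    by rewrite g1E g0E zE !mulgA invgM mulgVK mulVg mul1g.
  by apply: GM => //; exact: GV.
apply: eA; rewrite -ball_normE /=.
have := @mul_coord _ _ _ _ Hc v1 z v0 ltac:(lra) z1 ltac:(lra) (esym zE).
have : `|v1| * `|z| <= r * 1 by apply: ler_pM.
have -> : v0 - z = (v0 - (v1 + z)) + v1 by rewrite opprD [- v1 - z]addrC addrA subrK.
have := ler_normD (v0 - (v1 + z)) v1; lra.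
Qed.

(** Conjugating [phi s] by [ci x] adds two factors near the identity, each costing a factor 4 in the
    Lipschitz constant, whence [16 * L]. Dividing the iterates by their vanishing distance to [G]
    gives elements of [G] with the same limit, and [G] is closed. *)
Lemma conj_into_subgroup (K : topGroupType) (phi : K -> U) (G : set U) (F : set E) (L a : R) :
  compact [set: K] -> top_morphism phi -> is_subgroup G -> closed_subspace F ->
  (forall x, `|x| <= 1 -> (G (ci x) <-> F x)) ->
  1 <= L -> 0 < a -> 200 * (16 * L) * (16 * L) * a <= 1 ->
  (forall s, conj_lip ci L (phi s)) ->
  (forall s, exists y g, [/\ phi s = (ci y * g)%g, `|y| <= a & G g]) ->
  exists2 x : E, `|x| <= 4 * a & forall s, G ((ci x)^-1 * phi s * ci x)%g.
Proof.
move=> Kc [phic phiM] GG FF GF L1 a0 La phiL phiG.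
have aLL : a <= L * L * a by apply: ler_peMl; [exact: ltW|exact: mulr_ege1].
have a200 : a <= 1 / 200 by lra.
have c0 : 0 <= 2 * a by lra.
pose conj x s := ((ci x)^-1 * phi s * ci x)%g.
have conj_morph x : top_morphism (conj x).
  split.
    move=> s; apply: cvg_mulg; last exact: cvg_cst.
    by apply: cvg_mulg; [exact: cvg_cst|exact: phic].
  by move=> s t; rewrite /conj phiM !mulgA mulgK.
have conjL x s : `|x| <= 1 / 4 -> conj_lip ci (16 * L) (conj x s).
  have h12 : (1 / 4 : R) <= 1 / 2 by lra.
  move=> x4; have [v [vE _ vb]] := apx_inv Hc h12 (apx_exact ci x4).
  have -> : 16 * L = 4 * L * 4 by ring.
  apply: conj_lipM; [lra|lra| |by apply: (conj_lip_small Hc); lra].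
  by apply: conj_lipM => //; [lra|rewrite vE; apply: (conj_lip_small Hc); lra].
pose P n (w : unit -> E) := forall s, exists y g,
  [/\ conj (w tt) s = (ci y * g)%g, `|y| <= a / 2 ^+ n & G g].
have [||w_ [w [w_P w_b w_w wb ww_]]] := @geometric_iteration R E unit P (fun=> 0) (2 * a) c0.
- by move=> s; rewrite expr0 divr1 /conj (lc0 Hc) invg1 mul1g mulg1.
- move=> n w Pw wb; have {}wb : `|w tt| <= 4 * a by have := wb tt; rewrite subr0; lra.
  have p2 : 1 <= 2 ^+ n :> R by rewrite exprn_ege1// ler1n.
  have an0 : 0 < a / 2 ^+ n by rewrite divr_gt0//; lra.
  have ana : a / 2 ^+ n <= a by rewrite ler_pdivrMr; [rewrite ler_peMr//|]; lra.
  have L16 : 1 <= 16 * L by lra.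
  have [||m ma mP] := conj_step Hc Kc (conj_morph (w tt)) GG FF GF L16 an0 _ _ Pw.
  + have : 0 <= L * L * (a - a / 2 ^+ n) by rewrite !mulr_ge0//; lra.
    lra.
  + by move=> s; apply: conjL; lra.
  have w1 : `|w tt| <= 1 by lra.
  have m1 : `|m| <= 1 by lra.
  have [w' w'E w'b] := lc_mul Hc w1 m1.
  exists (fun=> w') => [s|[]].
    have [y [g [yE yb Gg]]] := mP s; exists y, g; split => //.
      by rewrite -yE /conj -w'E invgM !mulgA.
    by rewrite exprSr invfM mulrA.
  have -> : w' - w tt = (w' - (w tt + m)) + m by rewrite opprD addrA subrK.
  apply: le_trans (ler_normD _ _) _.
  have : `|w tt| * `|m| <= 1 * `|m| by rewrite ler_wpM2r.
  have := normr_ge0 m; lra.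
have {}wb : `|w tt| <= 4 * a by have := wb tt; rewrite subr0; lra.
exists (w tt) => // s.
have w_c : (fun n => ci (w_ n tt)) @ \oo --> ci (w tt).
  apply: (cvg_log_inv Hc); [exact: w_w| |by lra].
  by move=> n; have := w_b n tt; rewrite subr0; lra.
have /choice [y yP] : forall n, exists y, `|y| <= a / 2 ^+ n /\ G ((ci y)^-1 * conj (w_ n tt) s)%g.
  by move=> n; have [y [g [-> yb Gg]]] := w_P n s; exists y; split => //; rewrite mulKg.
have y_c : (fun n => ci (y n)) @ \oo --> (1%g : U).
  move=> A /(lc_nbhs Hc) [e e0 eA]; have [N NP] := @half_pow_small _ a e e0.
  by exists N => // n /= Nn; apply: eA; apply: le_trans (NP n Nn); case: (yP n).
apply: (@closed_cvg _ _ \oo _ (fun n => (ci (y n))^-1 * conj (w_ n tt) s)%g _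
  (subgroup_closed GG FF GF)).
  by near=> n; case: (yP n).
rewrite -[X in _ --> X]mul1g -{1}[1%g]invg1.
apply: cvg_mulg; first exact: cvg_invg.
apply: cvg_mulg => //; apply: cvg_mulg; last exact: cvg_cst.
exact: cvg_invg.
Unshelve. all: by end_near.
Qed.

End Conjugation.

(** * Analytic maps and the chart at the identity *)

Section StrictDiff.
Variable R : realType.

(** Strict differentiability with a quantitative remainder, the form in which analyticity is used
    below. It composes well, and comparing two nearby points, rather than one point with [x], is
    what produces the bound in [|x| |y|] for the product. *)
Definition sdiff (V W : normedModType R) (f : V -> W) (x : V) (L : V -> W) : Prop :=
  [/\ linear L, exists2 B, 0 <= B & forall v, `|L v| <= B * `|v| &
    exists C r : R, [/\ 0 <= C, 0 < r &
      forall h h', `|h| < r -> `|h'| < r ->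
        `|f (x + h) - f (x + h') - L (h - h')| <= C * (`|h| + `|h'|) * `|h - h'|]].

Section Analytic.
Variables (V W : normedModType R).

Lemma multilinear_diag n (a : ('I_n -> V) -> W) (D b : R) (h h' : V) :
  multilinear a -> (forall v, `|a v| <= D * \prod_i `|v i|) -> 0 <= D ->
  `|h| <= b -> `|h'| <= b ->
  `|a (fun=> h) - a (fun=> h')| <= n%:R * (D * (b ^+ n.-1 * `|h - h'|)).
Proof.
move=> am aD D0 hb h'b.
(* Telescoping: the arguments equal to [h] are replaced by [h'] one at a time. *)
pose v k (j : 'I_n) := if (j < k)%N then h' else h.
have -> : a (fun=> h) - a (fun=> h') = \sum_(i < n) (a (v i) - a (v i.+1)).
  rewrite -[RHS]opprK -sumrN (eq_bigr (fun i : 'I_n => a (v i.+1) - a (v i))); last first.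
    by move=> i _; rewrite opprB.
  rewrite -(big_mkord xpredT (fun i => a (v i.+1) - a (v i))) telescope_sumr// opprB.
  congr (a _ - a _); apply/funext => j; rewrite /v ?ltn0//.
  by rewrite ltn_ord.
apply: le_trans (ler_norm_sum _ _ _) _.
apply: (@le_trans _ _ (\sum_(i < n) (D * (b ^+ n.-1 * `|h - h'|)))); last first.
  by rewrite sumr_const card_ord mulr_natl.
apply: ler_sum => i _.
have := am (v i) i 1 (h - h') h'; rewrite !scale1r subrK.
have -> : ([eta v i with i |-> h] : 'I_n -> V) = v i.
  by apply/funext => j /=; case: eqP => // ->; rewrite /v ltnn.
have -> : ([eta v i with i |-> h'] : 'I_n -> V) = v i.+1.
  apply/funext => j /=; rewrite /v ltnS; case: (eqVneq j i) => [->|ji].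
    by rewrite leqnn.
  by rewrite [(j <= i)%N]leq_eqVlt (negbTE (_ : j != i :> nat)).
move=> ->; rewrite addrK; apply: le_trans (aD _) _; rewrite ler_wpM2l//.
rewrite (bigD1 i)//= eqxx mulrC ler_wpM2r//.
apply: (@le_trans _ _ (\prod_(j < n | j != i) b)).
  apply: ler_prod => j ji; rewrite normr_ge0 (negbTE ji) /v.
  by case: ifP.
by rewrite prodr_const cardC1 card_ord.
Qed.

Lemma analytic_sdiff (f : V -> W) (x : V) : analytic_at f x -> exists L, sdiff f x L.
Proof.
move=> [a [C [r [r0 am aC af]]]].
have C0 : 0 <= C.
  have := aC 0%N (fun=> 0); rewrite big_ord0 expr0 invr1 !mulr1.
  exact: le_trans.
pose L v := a 1%N (fun=> v).
have Llin : linear L.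
  move=> c u v; have := am 1%N (fun=> 0) ord0 c u v.
  have E w : ([eta (fun=> 0) with ord0 |-> w] : 'I_1 -> V) = (fun=> w).
    by apply/funext => j /=; rewrite (ord1 j).
  by rewrite !E.
exists L; split => //.
  exists (C * r^-1); first by rewrite mulr_ge0// invr_ge0 ltW.
  by move=> v; have := aC 1%N (fun=> v); rewrite big_ord1 expr1.
(* On this ball [(|h| + |h'|) / r <= 1 / 4]; the powers of [1 / 4] absorb the factor [n], at most
   [2 ^+ n], of [multilinear_diag], and still leave a geometric series of ratio [1 / 2]. *)
exists (16 * C * r^-1 * r^-1), (r / 8); split; first by rewrite !mulr_ge0// invr_ge0 ltW.
  by rewrite divr_gt0.
move=> h h' hr h'r.
pose b := `|h| + `|h'|; pose D := 16 * C * r^-1 * r^-1 * b * `|h - h'|.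
have b0 : 0 <= b by rewrite addr_ge0.
have D0 : 0 <= D by rewrite !mulr_ge0// invr_ge0 ltW.
have hb : `|h| <= b by rewrite lerDl.
have h'b : `|h'| <= b by rewrite lerDr.
have br : b * r^-1 <= 4^-1 by rewrite ler_pdivrMr//; rewrite /b; lra.
have br0 : 0 <= b * r^-1 by rewrite divr_ge0// ltW.
have term k : `|a k.+2 (fun=> h) - a k.+2 (fun=> h')| <= D / 2 ^+ k.+2.
  have Ck : 0 <= C * r ^- k.+2 by rewrite mulr_ge0// invr_ge0 exprn_ge0// ltW.
  apply: le_trans (multilinear_diag (am _) (aC _) Ck hb h'b) _ => /=.
  have -> : k.+2%:R * (C * r ^- k.+2 * (b ^+ k.+1 * `|h - h'|)) =
     (C * r^-1 * r^-1 * b * `|h - h'|) * (k.+2%:R * (b * r^-1) ^+ k).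
    by rewrite exprMn !exprS !invfM exprVn; ring.
  have -> : D / 2 ^+ k.+2 = (C * r^-1 * r^-1 * b * `|h - h'|) * (16 / 2 ^+ k.+2).
    by rewrite /D; ring.
  apply: ler_wpM2l; first by rewrite !mulr_ge0// invr_ge0 ltW.
  have q : (b * r^-1) ^+ k <= 4^-1 ^+ k by rewrite lerXn2r// nnegrE// invr_ge0.
  apply: le_trans (ler_wpM2l _ q) _ => //.
  have -> : 16 / 2 ^+ k.+2 = 2 ^+ k.+2 * 4^-1 ^+ k :> R.
    have -> : 4^-1 = 2^-1 * 2^-1 :> R by field.
    by rewrite !exprS exprMn exprVn; field; rewrite expf_neq0.
  by rewrite ler_wpM2r ?exprn_ge0 ?invr_ge0// -natrX ler_nat ltnW// ltn_expl.
(* Partial sums are taken from index 2, where the constant terms have cancelled and the linear ones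
   are exactly [L (h - h')]. *)
have part N : `|series (fun n => a n (fun=> h)) N.+2 - series (fun n => a n (fun=> h')) N.+2
     - L (h - h')| <= D * (1 / 2 - 1 / 2 ^+ N.+1).
  elim: N => [|N IH].
    rewrite /series /= !big_nat_recr//= !big_geq// !add0r.
    have -> : (fun _ : 'I_0 => h) = (fun=> h') by apply/funext => -[].
    have -> : a 1%N (fun=> h) = L (h - h') + a 1%N (fun=> h').
      by have := Llin 1 (h - h') h'; rewrite !scale1r subrK.
    by rewrite opprD addrACA subrr add0r addrK subrr normr0 expr1 subrr mulr0.
  rewrite seriesSr [series (fun n => a n (fun=> h')) N.+3]seriesSr.
  have -> : 1 / 2 - 1 / 2 ^+ N.+2 = 1 / 2 - 1 / 2 ^+ N.+1 + 1 / 2 ^+ N.+2 :> R.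
    by rewrite [2 ^+ N.+2]exprS; field; rewrite expf_neq0.
  have := term N; move: IH.
  move: (series _ _) (series _ _) (a N.+2 (fun=> h)) (a N.+2 (fun=> h')) => S' S t t' IH tt.
  have -> : S + t - (S' + t') - L (h - h') = (S - S' - L (h - h')) + (t - t').
    by rewrite opprD [S + t + _]addrACA [LHS]addrAC.
  apply: le_trans (ler_normD _ _) _; by rewrite mulrDr; apply: lerD => //; rewrite mul1r.
have lim : (fun n => series (fun n => a n (fun=> h)) n - series (fun n => a n (fun=> h')) n
     - L (h - h')) @ \oo --> f (x + h) - f (x + h') - L (h - h').
  apply: cvgB; last exact: cvg_cst.
  by apply: cvgB; apply: af; apply: lt_trans (_ : r / 8 < r) => //; rewrite ltr_pdivrMr//; lra.
have -> : 16 * C * r^-1 * r^-1 * (`|h| + `|h'|) * `|h - h'| = D by [].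
have clD : closed [set z : W | `|z| <= D].
  rewrite (_ : [set z : W | _] = closed_ball_ Num.norm 0 D); first exact: closed_closed_ball_.
  by apply/funext => z; rewrite /closed_ball_ /= sub0r normrN.
apply: (closed_cvg _ clD _ _ lim); exists 2%N => // -[|[|n]]//= _.
apply: le_trans (part n) _; rewrite ler_piMr//.
have : 0 <= 1 / 2 ^+ n.+1 :> R by rewrite divr_ge0// exprn_ge0.
lra.
Qed.

End Analytic.

Lemma sdiff_comp (V W X : normedModType R) (f : V -> W) (g : W -> X) x L L' :
  sdiff f x L -> sdiff g (f x) L' -> sdiff (g \o f) x (L' \o L).
Proof.
move=> [Ll [B B0 LB] [C [r [C0 r0 fP]]]] [Ll' [B' B0' LB'] [C' [r' [C0' r0' gP]]]].
split.
- by move=> c u v; rewrite /= Ll Ll'.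
- exists (B' * B) => [|v]; first exact: mulr_ge0.
  by apply: le_trans (LB' _) _; rewrite -mulrA ler_wpM2l.
pose M := B + 2 * C * r.
have M0 : 0 <= M by rewrite addr_ge0// !mulr_ge0// ltW.
have lip h h' : `|h| < r -> `|h'| < r -> `|f (x + h) - f (x + h')| <= M * `|h - h'|.
  move=> hr h'r; rewrite -[f (x + h) - _](subrK (L (h - h'))).
  apply: le_trans (ler_normD _ _) _; have := fP h h' hr h'r; have := LB (h - h').
  have : C * (`|h| + `|h'|) * `|h - h'| <= C * (2 * r) * `|h - h'|.
    by rewrite ler_wpM2r// ler_wpM2l//; lra.
  rewrite /M; lra.
pose s := Num.min r (r' / (M + 1)).
have M1 : 0 < M + 1 by lra.
have s0 : 0 < s by rewrite lt_min r0 divr_gt0.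
exists (B' * C + C' * M * M), s; split => //; first by rewrite addr_ge0// !mulr_ge0.
move=> h h'; rewrite !lt_min => /andP [hr hs] /andP [h'r h's].
have f0 k : `|k| < r -> `|k| < r' / (M + 1) ->
    `|f (x + k) - f x| <= M * `|k| /\ `|f (x + k) - f x| < r'.
  move=> kr ks; have := lip k 0 kr; rewrite normr0 addr0 subr0 => /(_ r0) fk; split => //.
  move: ks; rewrite ltr_pdivlMr// => ks; apply: le_lt_trans fk _.
  have := normr_ge0 k; lra.
have [fh fhr] := f0 h hr hs; have [fh' fhr'] := f0 h' h'r h's.
have := gP _ _ fhr fhr'; rewrite ![f x + _]addrC !subrK.
have -> : f (x + h) - f x - (f (x + h') - f x) = f (x + h) - f (x + h').
  by rewrite opprB addrA subrK.
move=> gh.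
have LS u v : L' (u - v) = L' u - L' v by rewrite -scaleN1r addrC Ll' scaleN1r addrC.
rewrite /= -[g (f (x + h)) - _](subrK (L' (f (x + h) - f (x + h')))) -[_ + _ - L' (L _)]addrA -LS.
apply: le_trans (ler_normD _ _) _.
have h1 := lip h h' hr h'r.
have h2 := fP h h' hr h'r.
have h3 := LB' (f (x + h) - f (x + h') - L (h - h')).
have h4 : B' * `|f (x + h) - f (x + h') - L (h - h')| <= B' * (C * (`|h| + `|h'|) * `|h - h'|).
  by rewrite ler_wpM2l.
have h5 : C' * (`|f (x + h) - f x| + `|f (x + h') - f x|) * `|f (x + h) - f (x + h')| <=
   C' * (M * (`|h| + `|h'|)) * (M * `|h - h'|).
  apply: ler_pM => //; first by rewrite mulr_ge0.
  by rewrite ler_wpM2l// mulrDr; exact: lerD.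
lra.
Qed.

Lemma sdiff_near (V W : normedModType R) (f g : V -> W) x L :
  (\forall y \near x, f y = g y) -> sdiff f x L -> sdiff g x L.
Proof.
move=> /nbhs_ballP [e /= e0 fg] [Ll LB [C [r [C0 r0 fP]]]]; split => //.
exists C, (Num.min e r); split => //; first by rewrite lt_min e0.
have fgE h : `|h| < e -> f (x + h) = g (x + h).
  by move=> he; apply: fg; rewrite -ball_normE /= opprD addrA subrr sub0r normrN.
move=> h h'; rewrite !lt_min => /andP [he hr] /andP [he' hr'].
by rewrite -!fgE//; exact: fP.
Qed.

Lemma sdiff_pair (V W V' W' : normedModType R) (f : V -> W) (f' : V' -> W') x x' L L' :
  sdiff f x L -> sdiff f' x' L' ->
  sdiff (fun z : V * V' => (f z.1, f' z.2)) (x, x') (fun z => (L z.1, L' z.2)).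
Proof.
move=> [Ll [B B0 LB] [C [r [C0 r0 fP]]]] [Ll' [B' B0' LB'] [C' [r' [C0' r0' fP']]]].
have n1 (T T' : normedModType R) (z : T * T') : `|z.1| <= `|z| by rewrite prod_normE le_max lexx.
have n2 (T T' : normedModType R) (z : T * T') : `|z.2| <= `|z|
  by rewrite prod_normE le_max lexx orbT.
split.
- by move=> c u v; rewrite /= Ll Ll'.
- exists (B + B') => [|v]; first exact: addr_ge0.
  rewrite prod_normE ge_max /=; apply/andP; split.
    apply: le_trans (LB _) _; apply: ler_pM => //; lra.
  by apply: le_trans (LB' _) _; apply: ler_pM => //; lra.
exists (C + C'), (Num.min r r'); split; [exact: addr_ge0|by rewrite lt_min r0|].
move=> h h'; rewrite !lt_min => /andP [hr hs] /andP [h'r h's].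
have le c k k' k'' : 0 <= c -> c <= C + C' -> 0 <= k -> 0 <= k' -> 0 <= k'' ->
  k <= `|h| -> k' <= `|h'| -> k'' <= `|h - h'| ->
  c * (k + k') * k'' <= (C + C') * (`|h| + `|h'|) * `|h - h'|.
  move=> *; apply: ler_pM => //; first by rewrite mulr_ge0// addr_ge0.
  by apply: ler_pM => //; [rewrite addr_ge0|exact: lerD].
rewrite prod_normE ge_max /=; apply/andP; split.
  apply: le_trans (fP h.1 h'.1 _ _) _; [exact: le_lt_trans hr|exact: le_lt_trans h'r|].
  by apply: le => //; [lra|exact: (n1 _ _ (h - h'))].
apply: le_trans (fP' h.2 h'.2 _ _) _; [exact: le_lt_trans hs|exact: le_lt_trans h's|].
by apply: le => //; [lra|exact: (n2 _ _ (h - h'))].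
Qed.

Lemma sdiff_cst_pair (V W : normedModType R) (c : W) (x : V) :
  sdiff (fun y => (c, y)) x (fun v => (0, v) : W * V).
Proof.
split.
- by move=> a u v; congr (_, _); rewrite /= scaler0 addr0.
- exists 1 => // v; rewrite prod_normE /= normr0 mul1r ge_max normr_ge0 lexx//.
exists 0, 1; split => // h h' _ _; rewrite !mul0r normr_le0; apply/eqP.
congr (_, _) => /=; first by rewrite !subrr.
by rewrite opprD addrACA subrr add0r subrr.
Qed.

Lemma sdiff_pair_cst (V W : normedModType R) (c : W) (x : V) :
  sdiff (fun y => (y, c)) x (fun v => (v, 0) : V * W).
Proof.
split.
- by move=> a u v; congr (_, _); rewrite /= scaler0 addr0.
- exists 1 => // v; rewrite prod_normE /= normr0 mul1r ge_max normr_ge0 lexx//.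
exists 0, 1; split => // h h' _ _; rewrite !mul0r normr_le0; apply/eqP.
congr (_, _) => /=; last by rewrite !subrr.
by rewrite opprD addrACA subrr add0r subrr.
Qed.

Lemma sdiff_lipschitz (V W : normedModType R) (f : V -> W) x L M :
  sdiff f x L -> (forall v, `|L v| <= M * `|v|) ->
  exists2 r, 0 < r & forall h, `|h| < r -> `|f (x + h) - f x| <= (M + 1) * `|h|.
Proof.
move=> [_ _ [C [r [C0 r0 fP]]]] LM.
have C1 : 0 < C + 1 by lra.
exists (Num.min r (C + 1)^-1); first by rewrite lt_min r0 invr_gt0.
move=> h; rewrite lt_min => /andP [hr hC].
have := fP h 0 hr; rewrite normr0 !addr0 subr0 => /(_ r0) fh.
rewrite -[f (x + h) - _](subrK (L h)); apply: le_trans (ler_normD _ _) _.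
have := LM h; have := normr_ge0 h => h0.
have : C * `|h| * `|h| <= 1 * `|h|.
  rewrite ler_wpM2r//; move: hC; rewrite -[ltRHS]div1r ltr_pdivlMr//; lra.
lra.
Qed.

Lemma sdiff_diff (V W : normedModType R) (f : V -> W) x L :
  sdiff f x L -> 'd f x = L :> (V -> W).
Proof.
move=> [Ll [B B0 LB] [C [r [C0 r0 fP]]]].
pose L' := GRing.isLinear.Build R V W *:%R L Ll.
pose LL : {linear V -> W} := HB.pack L L'.
have -> : L = LL :> (V -> W) by [].
have LS u v : L (u - v) = L u - L v by rewrite -scaleN1r addrC Ll scaleN1r addrC.
apply: diff_unique.
  move=> y; apply/cvgrPdist_le => e e0; near=> z.
  rewrite -LS; apply: le_trans (LB _) _.
  apply: (@le_trans _ _ ((B + 1) * `|y - z|)); first by rewrite ler_wpM2r//; lra.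
  rewrite mulrC -ler_pdivlMr; last lra.
  by near: z; apply: cvgr_dist_le; [exact: cvg_id|rewrite divr_gt0//; lra].
apply/eqaddoP => e e0; near=> h => /=.
have hr : `|h| < Num.min r (e / (C + 1)).
  near: h; apply/nbhs_ballP; exists (Num.min r (e / (C + 1))) => /=.
    by rewrite lt_min r0 divr_gt0//; lra.
  by move=> h; rewrite -ball_normE /= sub0r normrN.
move: hr; rewrite lt_min => /andP [hr hC].
have := fP h 0 hr; rewrite normr0 !addr0 subr0 => /(_ r0) fh.
rewrite -[X in `|X|]/(f (h + x) - (f x + L h)) [h + x]addrC opprD addrA.
apply: le_trans fh _; rewrite ler_wpM2r//.
by move: hC; rewrite ltr_pdivlMr; [have := normr_ge0 h|]; lra.
Unshelve. all: by end_near.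
Qed.
End StrictDiff.

(** Comparing [(x, y)] with [(x, 0)], and [(0, y)] with [(0, 0)], eliminates [L] and bounds the
    error by [max(|x|, |y|) |y|]. The symmetric comparison gives [max(|x|, |y|) |x|], and the better
    of the two is [|x| |y|]. *)
Lemma sdiff_mul_bound (R : realType) (V : normedModType R) (f : V * V -> V) (p : V) L :
  sdiff f (p, p) L -> (\forall x \near p, f (x, p) = x /\ f (p, x) = x) ->
  exists C r : R, [/\ 0 <= C, 0 < r & forall x y, `|x| < r -> `|y| < r ->
    `|f (p + x, p + y) - p - (x + y)| <= C * `|x| * `|y|].
Proof.
move=> [_ _ [C [r [C0 r0 fP]]]] /nbhs_ballP [e /= e0 fe].
exists (3 * C), (Num.min r e); split; [lra|by rewrite lt_min r0|].
move=> x y; rewrite !lt_min => /andP [xr xe] /andP [yr ye].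
have fx z : `|z| < e -> f (p + z, p) = p + z /\ f (p, p + z) = p + z.
  by move=> ze; apply: fe; rewrite -ball_normE /= opprD addrA subrr sub0r normrN.
have f0 : f (p, p) = p by have [] := fx 0; rewrite ?normr0// addr0.
have fP' x1 y1 x2 y2 : `|x1| < r -> `|y1| < r -> `|x2| < r -> `|y2| < r ->
    `|f (p + x1, p + y1) - f (p + x2, p + y2) - L (x1 - x2, y1 - y2)| <=
    C * (`|(x1, y1) : V * V| + `|(x2, y2) : V * V|) * `|(x1 - x2, y1 - y2) : V * V|.
  by move=> *; apply: (fP (x1, y1) (x2, y2)); rewrite prod_normE /= gt_max; apply/andP.
have x0 := normr_ge0 x; have y0 := normr_ge0 y.
set m := Num.max `|x| `|y|.
have [xm ym] : `|x| <= m /\ `|y| <= m by rewrite /m !le_max !lexx orbT.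
have n1 z : `|(z, 0) : V * V| = `|z| by rewrite prod_normE /= normr0 max_l.
have n2 z : `|(0, z) : V * V| = `|z| by rewrite prod_normE /= normr0 max_r.
have n12 : `|(x, y) : V * V| = m by rewrite prod_normE.
have z0 : `|0 : V| < r by rewrite normr0.
have splitE F u v l : F - p - (u + v) = (F - (p + u) - l) - (p + v - p - l).
  by rewrite [in RHS]opprB [in RHS]addrA subrK [p + v]addrC addrK !opprD !addrA.
have hy : `|f (p + x, p + y) - p - (x + y)| <= 3 * C * m * `|y|.
  have := fP' x y x 0 xr yr xr z0; have := fP' 0 y 0 0 z0 yr z0 z0.
  rewrite !addr0 !subr0 !subrr !n1 !n2 n12 normr0 addr0 f0 (fx x xe).1 (fx y ye).2.
  move=> h1 h2.
  rewrite (splitE _ x y (L (0, y))).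
  apply: le_trans (ler_normB _ _) _.
  have : C * (m + `|x|) * `|y| <= C * (m + m) * `|y| by rewrite ler_wpM2r// ler_wpM2l//; lra.
  have : C * `|y| * `|y| <= C * m * `|y| by rewrite ler_wpM2r// ler_wpM2l.
  lra.
have hx : `|f (p + x, p + y) - p - (x + y)| <= 3 * C * m * `|x|.
  have := fP' x y 0 y xr yr z0 yr; have := fP' x 0 0 0 xr z0 z0 z0.
  rewrite !addr0 !subr0 !subrr !n1 !n2 n12 normr0 addr0 f0 (fx x xe).1 (fx y ye).2.
  move=> h1 h2.
  rewrite [x + y]addrC (splitE _ y x (L (x, 0))).
  apply: le_trans (ler_normB _ _) _.
  have : C * (m + `|y|) * `|x| <= C * (m + m) * `|x| by rewrite ler_wpM2r// ler_wpM2l//; lra.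
  have : C * `|x| * `|x| <= C * m * `|x| by rewrite ler_wpM2r// ler_wpM2l.
  lra.
have [xy|yx] := leP `|x| `|y|.
  by move: hx; rewrite /m max_r// => h; apply: le_trans h _; lra.
by move: hy; rewrite /m max_l// ltW.
Qed.

(** * The group law in a chart at the identity *)

Section Charts.
Variables (R : realType) (U : banachLieGroup R).
Notation E := (blg_model U).
Local Notation coord := Defs.coord.
Local Notation coordK := Defs.coordK.
Notation c1 := (chart_at (1%g : U)).

Lemma cvg_coord_inv (c : chart U E) x : dom c x -> coord_inv c @ coord c x --> x.
Proof. by move=> dx; rewrite -[X in _ --> X](Defs.coordK dx); exact: (coord_inv_continuous dx). Qed.

Lemma near_dom (c : chart U E) x : dom c x -> \forall y \near x, dom c y.
Proof. by move=> dx; apply: open_nbhs_nbhs; split => //; exact: dom_open. Qed.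

Lemma near_coord_dom (c : chart U E) x : dom c x ->
  \forall y \near coord c x, exists2 u, dom c u & coord c u = y.
Proof.
move=> dx; have : nbhs (coord c x) (coord c @` dom c).
  by apply: open_nbhs_nbhs; split; [exact: coord_open|exists x].
by apply: filterS => y [u du <-]; exists u.
Qed.

Lemma admissible_transition (c : chart U E) : admissible c -> dom c 1%g ->
  (exists L, sdiff (coord c1 \o coord_inv c) (coord c 1%g) L) /\
  (exists L, sdiff (coord c \o coord_inv c1) (coord c1 1%g) L).
Proof.
move=> ac d1; have [h1 h2] := ac 1%g 1%g d1 (chart_at_dom _).
by split; exact: analytic_sdiff.
Qed.

(** [mulg_analytic] speaks of the chosen charts, whereas a submanifold chart is merely admissible.
    The product is transported by the transition maps, and the formulas agree near the base
    point. *)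
Lemma mulg_sdiff (c : chart U E) : admissible c -> dom c 1%g ->
  exists L, sdiff (fun z : E * E => coord c (coord_inv c z.1 * coord_inv c z.2)%g)
    (coord c 1%g, coord c 1%g) L.
Proof.
move=> ac d1; have [[L1 s1] [L2 s2]] := admissible_transition ac d1.
have d1' : dom c1 1%g by exact: chart_at_dom.
have := @mulg_analytic _ U 1%g 1%g; rewrite mulg1 => /analytic_sdiff [L3 s3].
have s11 := sdiff_pair s1 s1.
have c11 : coord c1 (coord_inv c (coord c 1%g)) = coord c1 1%g by rewrite coordK.
have s13 := sdiff_comp s11 (_ : sdiff _ _ L3).
have /s13 s4 : sdiff (fun z : E * E => coord c1 (coord_inv c1 z.1 * coord_inv c1 z.2)%g)
  ((coord c1 \o coord_inv c) (coord c 1%g, coord c 1%g).1,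
   (coord c1 \o coord_inv c) (coord c 1%g, coord c 1%g).2) L3.
  by rewrite /= c11.
have := sdiff_comp s4 (_ : sdiff (coord c \o coord_inv c1) _ L2).
rewrite /= c11 coordK// mulg1 => /(_ s2) s5.
eexists; apply: sdiff_near s5.
have cv : forall i : bool, (fun z : E * E => coord_inv c (if i then z.1 else z.2)) @
    ((coord c 1%g, coord c 1%g) : E * E) --> (1%g : U).
  by move=> [] /=; apply: cvg_comp (cvg_coord_inv d1); [exact: cvg_fst|exact: cvg_snd].
have cm : (fun z : E * E => coord_inv c z.1 * coord_inv c z.2)%g @
    ((coord c 1%g, coord c 1%g) : E * E) --> (1%g : U).
  by rewrite -[X in _ --> X]mulg1; apply: cvg_mulg; [exact: (cv true)|exact: (cv false)].
have n1 := cv true _ (near_dom d1'); have n2 := cv false _ (near_dom d1').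
have n3 := cm _ (near_dom d1').
near=> z; rewrite /= !coordK//.
- by near: z; first [exact: n1|exact: n2|exact: n3].
- by near: z; first [exact: n1|exact: n2|exact: n3].
- by near: z; first [exact: n1|exact: n2|exact: n3].
- by near: z; first [exact: n1|exact: n2|exact: n3].
- by near: z; first [exact: n1|exact: n2|exact: n3].
Unshelve. all: by end_near.
Qed.

Definition normalized (c : chart U E) (lam : R) (x : E) : U :=
  coord_inv c (coord c 1%g + lam *: x).

(** Continuity of the group operations alone shows that quotients have small coordinates; the linear
    bounds on these coordinates are then deduced from the product estimate. *)
Lemma normalized_log_chart (c : chart U E) : admissible c -> dom c 1%g ->
  exists lam : R, [/\ 0 < lam, log_chart (normalized c lam) &
    forall x, `|x| <= 4 -> exists2 u, dom c u & coord c u = coord c 1%g + lam *: x].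
Proof.
move=> ac d1; have [L sL] := mulg_sdiff ac d1.
set p := coord c 1%g in sL *.
have cp : coord_inv c p = 1%g by rewrite /p coordK.
have cK y : (exists2 u, dom c u & coord c u = y) ->
    dom c (coord_inv c y) /\ coord c (coord_inv c y) = y.
  by move=> [u du <-]; rewrite coordK.
have np := near_coord_dom d1.
have [|C [r1 [C0 r10 CP]]] := sdiff_mul_bound sL.
  apply: filterS np => x /cK [dx xE] /=.
  by rewrite cp mulg1 mul1g xE.
pose k x := coord_inv c (p + x).
have [r2 r20 kP] : exists2 r : R, 0 < r &
    forall x, `|x| < r -> dom c (k x) /\ coord c (k x) = p + x.
  have /nbhs_ballP [e /= e0 eP] := np; exists e => // x xe; apply: cK; apply: eP.
  by rewrite -ball_normE /= opprD addrA subrr sub0r normrN.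
have nbhsP (A : set U) : nbhs (1%g : U) A <-> exists2 e : R, 0 < e & forall x, `|x| < e -> A (k x).
  split.
    move=> /(cvg_coord_inv d1) /nbhs_ballP [e /= e0 eP]; exists e => // x xe; apply: eP.
    by rewrite -ball_normE /= opprD addrA subrr sub0r normrN.
  move=> [e e0 eP]; have := Defs.coord_continuous d1.
  move=> /cvgrPdist_lt /(_ _ e0); apply: filter_app.
  apply: filterS (near_dom d1) => u du.
  rewrite distrC => /eP; by rewrite /k addrC subrK coordK.
have [r3 [r30 mP dlP drP]] : exists r : R, [/\ 0 < r,
    forall x y, `|x| < r -> `|y| < r -> dom c (k x * k y)%g,
    forall x y, `|x| < r -> `|y| < r -> exists2 v, ((k x)^-1 * k y)%g = k v & `|v| < Num.min r1 r2 &
    forall x y, `|x| < r -> `|y| < r -> exists2 v, (k y * (k x)^-1)%g = k v & `|v| < Num.min r1 r2].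
  pose Q : set U := [set k v | v in [set v : E | `|v| < Num.min r1 r2]].
  have nQ : nbhs (1%g : U) Q.
    by apply/nbhsP; exists (Num.min r1 r2); [rewrite lt_min r10|move=> v vr; exists v].
  have nD := near_dom d1.
  have [B [B' [nB nB' BP]]] : exists B B', [/\ nbhs (1%g : U) B, nbhs (1%g : U) B' &
      forall b b', B b -> B' b' -> dom c (b * b')%g] by apply: nbhs_mulg; rewrite mulg1.
  have [C1 [C1' [nC1 nC1' C1P]]] : exists B B', [/\ nbhs (1%g : U) B, nbhs (1%g : U) B' &
      forall b b', B b -> B' b' -> Q (b * b')%g] by apply: nbhs_mulg; rewrite mulg1.
  have invn (A : set U) : nbhs (1%g : U) A -> nbhs (1%g : U) [set u | A (u^-1)%g].
    by move=> nA; apply: (@invg_continuous U 1%g); rewrite invg1.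
  have n6 : nbhs (1%g : U) ((B `&` B') `&` ((C1 `&` C1') `&`
      ([set u | C1 (u^-1)%g] `&` [set u | C1' (u^-1)%g]))).
    by do !apply: filterI => //; exact: invn.
  have [r r0 rP] := proj1 (nbhsP _) n6; exists r; split => // x y /rP [[Bx B'x] [[Cx C'x] [Ix I'x]]]
    /rP [[By B'y] [[Cy C'y] [Iy I'y]]].
  - exact: BP.
  - by have [v vr <-] := C1P _ _ Ix C'y; exists v.
  - by have [v vr <-] := C1P _ _ Cy I'x; exists v.
(* Dilating by [lam] multiplies the second-order constant by [lam], hence [C * lam <= 1 / 8]; the
   other minima bring the ball of radius 4 inside all the balls above. *)
pose lam := Num.min (Num.min (r1 / 8) (r2 / 8)) (Num.min (r3 / 8) (1 / (8 * (C + 1)))).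
have [l0 l1 l2 l3 lC] :
    [/\ 0 < lam, lam * 8 <= r1, lam * 8 <= r2, lam * 8 <= r3 & C * lam <= 1 / 8].
  have C8 : 0 < 8 * (C + 1) by lra.
  have lam0 : 0 < lam by rewrite !lt_min !divr_gt0.
  have : lam <= lam by []; rewrite {2}/lam !le_min => /andP [/andP [h1 h2] /andP [h3 h4]].
  by move: h4; rewrite ler_pdivlMr// => h4; split; [|lra..].
have kE x : normalized c lam x = k (lam *: x) by [].
have lx (x : E) b : `|x| <= b -> `|lam *: x| <= lam * b.
  by move=> xb; rewrite normrZ gtr0_norm// ler_wpM2l// ltW.
have lK (x : E) : lam *: (lam^-1 *: x) = x by rewrite scalerA divff ?scale1r// gt_eqF.
have lN (x : E) : `|lam^-1 *: x| = `|x| / lam by rewrite normrZ gtr0_norm ?invr_gt0// mulrC.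
have l4 (x : E) : `|x| <= 4 -> [/\ `|lam *: x| < r1, `|lam *: x| < r2 & `|lam *: x| < r3].
  by move=> /lx; move=> h; split; lra.
(* The product law determines [v] as [lam *: (y - x)] up to [|v| / 8], an error that is absorbed on
   the left. *)
have div_bound (x y v : E) : `|x| <= 1 ->
    `|p + lam *: y - p - (lam *: x + v)| <= C * `|lam *: x| * `|v| ->
    `|lam^-1 *: v| <= 2 * `|y - x|.
  move=> x1; rewrite [p + _]addrC addrK opprD addrA -scalerBr => h.
  rewrite lN ler_pdivrMr//.
  have := ler_normB (lam *: (y - x)) (lam *: (y - x) - v).
  rewrite subKr [`|lam *: (y - x)|]normrZ gtr0_norm//.
  have : C * `|lam *: x| * `|v| <= 1 / 8 * `|v|.
    rewrite ler_wpM2r//; apply: le_trans lC; rewrite ler_wpM2l//.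
    by have := lx _ _ x1; rewrite mulr1.
  have := normr_ge0 v; lra.
exists lam; split => //; last first.
  by move=> x /l4 [_ /kP [dk ck] _]; exists (k (lam *: x)).
have sml (x : E) : `|x| <= 1 -> `|x| <= 4 by move=> h; lra.
split.
- by rewrite kE scaler0 /k addr0.
- move=> x y /l4 [_ /kP [_ kx] _] /l4 [_ /kP [_ ky] _]; rewrite !kE => kxy.
  have : p + lam *: x = p + lam *: y by rewrite -kx -ky kxy.
  move/addrI => h; rewrite -[x]scale1r -[y]scale1r -(@mulVf _ lam) ?gt_eqF//.
  by rewrite -!scalerA h.
- move=> x y x1 y1; have [x_1 x_2 x_3] := l4 _ (sml _ x1); have [y_1 y_2 y_3] := l4 _ (sml _ y1).
  have dxy := mP _ _ x_3 y_3; set z0 := coord c (k (lam *: x) * k (lam *: y))%g - p.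
  have zE : (k (lam *: x) * k (lam *: y))%g = k z0.
    by rewrite {3}/k /z0 [p + (_ - p)]addrC subrK coordK.
  exists (lam^-1 *: z0); first by rewrite !kE lK.
  have := CP _ _ x_1 y_1; rewrite /= -/(k _) -/(k _) -/z0 !normrZ gtr0_norm//.
  have -> : lam^-1 *: z0 - (x + y) = lam^-1 *: (z0 - (lam *: x + lam *: y)).
    by rewrite -(scalerDr lam) [RHS]scalerBr [X in _ = _ - X]scalerA mulVf ?scale1r// gt_eqF.
  rewrite lN ler_pdivrMr// => h; apply: le_trans h _.
  have : 0 <= (1 / 8 - C * lam) * (lam * (`|x| * `|y|)).
    by rewrite !mulr_ge0// ?subr_ge0// ltW.
  lra.
- move=> x y x1 y1; have [x_1 x_2 x_3] := l4 _ (sml _ x1); have [y_1 y_2 y_3] := l4 _ (sml _ y1).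
  have [v vE] := dlP _ _ x_3 y_3; rewrite lt_min => /andP [v1 v2].
  have xv : (k (lam *: x) * k v)%g = k (lam *: y) by rewrite -vE mulgA mulgV mul1g.
  exists (lam^-1 *: v); first by rewrite !kE lK xv.
  have := CP _ _ x_1 v1; rewrite /= -/(k _) -/(k _) xv (kP _ y_2).2.
  by apply: div_bound.
- move=> x y x1 y1; have [x_1 x_2 x_3] := l4 _ (sml _ x1); have [y_1 y_2 y_3] := l4 _ (sml _ y1).
  have [v vE] := drP _ _ x_3 y_3; rewrite lt_min => /andP [v1 v2].
  have xv : (k v * k (lam *: x))%g = k (lam *: y) by rewrite -vE mulgVK.
  exists (lam^-1 *: v); first by rewrite !kE lK xv.
  have := CP _ _ v1 x_1; rewrite /= -/(k _) -/(k _) xv (kP _ y_2).2 [v + _]addrC mulrAC.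
  by apply: div_bound.
- move=> A; rewrite nbhsP; split.
    move=> [e e0 eA]; exists (e / (2 * lam)); first by rewrite divr_gt0// mulr_gt0.
    move=> x xe; rewrite kE; apply: eA; rewrite normrZ gtr0_norm//.
    move: xe; rewrite ler_pdivlMr ?mulr_gt0//; lra.
  move=> [a a0 aA]; exists (lam * a); first exact: mulr_gt0.
  move=> x xa; rewrite -[x]lK -kE; apply: aA; rewrite lN ler_pdivrMr// mulrC ltW//.
Qed.

End Charts.

(** * Conjugation and the adjoint representation *)

Section Adjoint.
Variables (R : realType) (U : banachLieGroup R).
Local Notation coord := Defs.coord.
Local Notation coordK := Defs.coordK.
Notation E := (blg_model U).
Notation c1 := (chart_at (1%g : U)).

(** Conjugation is left multiplication by [g], read in the chart at [g], followed by right
    multiplication by [g^-1]; both are restrictions of the analytic product. *)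
Lemma conj_sdiff (g : U) : exists L,
  sdiff (fun x => coord c1 (g * coord_inv c1 x * g^-1)%g) (coord c1 1%g) L.
Proof.
have dg : dom (chart_at g) g := chart_at_dom g.
have d1 : dom c1 1%g := chart_at_dom (1%g : U).
have := @mulg_analytic _ U g 1%g; rewrite mulg1 => /analytic_sdiff [L1 s1].
have := @mulg_analytic _ U g (g^-1)%g; rewrite mulgV => /analytic_sdiff [L2 s2].
have s3 := sdiff_comp (sdiff_cst_pair (coord (chart_at g) g) (coord c1 1%g)) s1.
have := sdiff_comp (sdiff_pair_cst (coord (chart_at (g^-1)%g) (g^-1)%g) (coord (chart_at g) g)) s2.
move=> s4.
have := sdiff_comp s3 (_ : sdiff _ _ ((L2 \o fun v => (v, 0)))).
rewrite /= coordK// coordK// mulg1 => /(_ _ s4) s5.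
eexists; apply: sdiff_near s5.
have cm : (fun y => g * coord_inv c1 y)%g @ coord c1 1%g --> g.
  rewrite -[X in _ --> X]mulg1; apply: cvg_mulg; first exact: cvg_cst.
  exact: cvg_coord_inv.
have nm := cm _ (near_dom dg).
near=> y; rewrite /= !coordK//; first exact: chart_at_dom.
by near: y; exact: nm.
Unshelve. all: by end_near.
Qed.

(** The differential of conjugation in the chart [c] is [Ad g] between two transition derivatives,
    so its bound is uniform in [g]. The ball where it controls conjugation does depend on [g], and
    [conj_lip_local] removes this dependence. *)
Lemma conj_lip_of_Ad (c : chart U E) (lam M : R) : admissible c -> dom c 1%g -> 0 < lam ->
  log_chart (normalized c lam) -> 0 <= M ->
  exists2 L, 1 <= L & forall g : U, (op_norm (Ad g) <= M%:E)%E -> conj_lip (normalized c lam) L g.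
Proof.
move=> ac d1 l0 Hc M0.
have [[L1 s1] [L2 s2]] := admissible_transition ac d1.
have [_ [B1 B10 LB1] _] := s1; have [_ [B2 B20 LB2] _] := s2.
pose K := B2 * (M * B1) + 1.
have K0 : 0 <= K by rewrite addr_ge0// !mulr_ge0.
exists (8 * (K + 1)); first lra.
move=> g gM; have [Lg sg] := conj_sdiff g.
have AdE : Ad g = Lg := sdiff_diff sg.
have [Ll _ _] := sg.
have LgM v : `|Lg v| <= M * `|v|.
  have [->|v0] := eqVneq v 0.
    have := Ll (-1) 0 0; rewrite scaler0 add0r scaleN1r addNr => ->.
    by rewrite !normr0 mulr0.
  have nv : 0 < `|v| by rewrite normr_gt0.
  have LZ a u : Lg (a *: u) = a *: Lg u.
    have := Ll a u 0; rewrite !addr0 => ->.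
    by have := Ll (-1) 0 0; rewrite scaler0 add0r scaleN1r addNr => ->; rewrite addr0.
  have : (`|Lg (`|v|^-1 *: v)|%:E <= M%:E)%E.
    apply: le_trans gM; apply: ereal_sup_ubound; exists (`|v|^-1 *: v); last by rewrite AdE.
    by rewrite /= normrZ normfV normr_id mulVf ?gt_eqF.
  by rewrite lee_fin LZ normrZ normfV normr_id ler_pdivrMl// mulrC.
have d1' : dom c1 1%g := chart_at_dom (1%g : U).
have := sdiff_comp s1 (_ : sdiff (fun x => coord c1 (g * coord_inv c1 x * g^-1)%g) _ Lg).
rewrite /= coordK// => /(_ sg) s3.
have := sdiff_comp s3 (_ : sdiff (coord c \o coord_inv c1) _ L2).
rewrite /= !coordK// mulg1 mulgV => /(_ s2) s4.
set p := coord c 1%g in s4 *.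
pose f y := coord c (g * coord_inv c y * g^-1)%g.
have cm : (fun y => g * coord_inv c y * g^-1)%g @ p --> (1%g : U).
  rewrite -[X in _ --> X](mulgV g) -[X in _ --> (X * _)%g]mulg1.
  apply: cvg_mulg; last exact: cvg_cst.
  by apply: cvg_mulg; [exact: cvg_cst|exact: cvg_coord_inv].
have s5 : sdiff f p (L2 \o (Lg \o L1)).
  have n1 := cvg_coord_inv d1 (near_dom d1'); have n2 := cm _ (near_dom d1').
  apply: sdiff_near s4; near=> y; rewrite /= !coordK//.
  - by near: y; first [exact: n1|exact: n2].
  - by near: y; first [exact: n1|exact: n2].
  - by near: y; first [exact: n1|exact: n2].
have fp : f p = p by rewrite /f /p coordK// mulg1 mulgV.
have [|r r0 fr] := @sdiff_lipschitz _ _ _ _ _ _ (B2 * (M * B1)) s5.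
  move=> v; apply: le_trans (LB2 _) _; rewrite -!mulrA ler_wpM2l//.
  by apply: le_trans (LgM _) _; rewrite ler_wpM2l.
rewrite -/K fp in fr.
have [e /= e0 eP] := (nbhs_ballP _ _).1 (cm _ (near_dom d1)).
pose r' := Num.min r e / (2 * lam).
have m0 : 0 < Num.min r e by rewrite lt_min r0.
apply: (@conj_lip_local _ _ _ _ Hc K g r') => //; first by rewrite divr_gt0// mulr_gt0.
move=> x; rewrite ler_pdivlMr ?mulr_gt0// => xr.
have : `|lam *: x| < Num.min r e.
  rewrite normrZ gtr0_norm//; have := mulr_ge0 (ltW l0) (normr_ge0 x); lra.
rewrite lt_min => /andP [lr le].
have dx : dom c (g * coord_inv c (p + lam *: x) * g^-1)%g.
  by apply: eP; rewrite -ball_normE /= opprD addrA subrr sub0r normrN.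
exists (lam^-1 *: (f (p + lam *: x) - p)).
  rewrite /normalized -/p scalerA divff ?gt_eqF// scale1r [p + (_ - p)]addrC subrK.
  by rewrite /f coordK.
rewrite normrZ gtr0_norm ?invr_gt0// ler_pdivrMl//.
by have := fr _ lr; rewrite normrZ gtr0_norm//; lra.
Unshelve. all: by end_near.
Qed.

(** The chart need not be centred, but [coord c 1] itself lies in [F] since the identity is in [G];
    translating by it and dilating preserve [F]. *)
Lemma normalized_subgroup (c : chart U E) (lam : R) (G : set U) (F : set E) :
  dom c 1%g -> 0 < lam -> G 1%g -> closed_subspace F ->
  coord c @` (dom c `&` G) = coord c @` dom c `&` F ->
  (forall x, `|x| <= 4 -> exists2 u, dom c u & coord c u = coord c 1%g + lam *: x) ->
  forall x, `|x| <= 1 -> (G (normalized c lam x) <-> F x).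
Proof.
move=> d1 l0 G1 [_ F0 FD] cG ran x x1.
have [|u du uE] := ran x; first by apply: le_trans x1 _; rewrite ler1n.
have GF v : dom c v -> (G v <-> F (coord c v)).
  move=> dv; split => [Gv|Fv].
    have : (coord c @` dom c `&` F) (coord c v) by rewrite -cG; exists v.
    by case.
  have : (coord c @` (dom c `&` G)) (coord c v) by rewrite cG; split => //; exists v.
  by case=> w [dw Gw] wv; rewrite -(coordK dv) -wv coordK.
have Fp : F (coord c 1%g) by apply/GF.
have -> : normalized c lam x = u by rewrite /normalized -uE coordK.
rewrite GF// uE; split => Fx; last first.
  by rewrite addrC; apply: FD.
have := FD (- lam^-1) _ _ Fp (FD lam^-1 _ _ Fx F0).
by rewrite addr0 scalerDr addrA scaleNr addNr add0r scalerA mulVf ?scale1r// gt_eqF.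
Qed.

End Adjoint.

(** * Invariant metrics *)

Section Metric.
Variables (R : realType) (M : topologicalType) (d : M -> M -> R) (hd : complete_metric d).

Lemma metric_xx x : d x x = 0. Proof. exact/(Defs.metric_eq0 hd). Qed.

Lemma metric_ge0 x y : 0 <= d x y.
Proof.
by have := Defs.metric_triangle hd x y x; rewrite metric_xx [d y x](Defs.metric_sym hd); lra.
Qed.

Lemma metric_hausdorff : hausdorff_space M.
Proof.
move=> x y xy; apply/(Defs.metric_eq0 hd)/eqP; rewrite eq_le metric_ge0 andbT leNgt.
apply/negP => d0; have d2 : 0 < d x y / 2 by rewrite divr_gt0.
have bn z : nbhs z [set w | d z w < d x y / 2].
  by apply/(Defs.metric_nbhs hd); exists (d x y / 2).
have [z [/= xz yz]] := xy _ _ (bn x) (bn y).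
have := Defs.metric_triangle hd x z y; rewrite [d z y](Defs.metric_sym hd); lra.
Qed.

(** Pointwise strict bounds by [eps] would not make the supremum smaller than [eps], hence the
    margin. *)
Lemma eps_close_half (K : Type) (eps : R) (f g : K -> M) : 0 < eps ->
  (forall s, d (f s) (g s) <= eps / 2) -> eps_close d eps f g.
Proof.
move=> e0 fg; apply: (@le_lt_trans _ _ (eps / 2)%:E).
  by apply: ge_ereal_sup => _ [s _ <-]; rewrite lee_fin.
by rewrite lte_fin ltr_pdivrMr// ltr_pMr// ltr1n.
Qed.

End Metric.

Section LogMetric.
Variables (R : realType) (U : topGroupType) (E : completeNormedModType R).
Variables (ci : E -> U) (Hc : log_chart ci) (d : U -> U -> R) (hd : complete_metric d).

Lemma metric_log a : 0 < a -> exists2 e : R, 0 < e &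
  forall u, d 1%g u < e -> exists2 x, u = ci x & `|x| <= a.
Proof.
move=> a0; have /(Defs.metric_nbhs hd) [e e0 eP] := log_ball_nbhs Hc a0.
by exists e => // u /eP [x xa <-]; exists x.
Qed.

Lemma log_metric e : 0 < e -> exists2 a : R, 0 < a & forall x, `|x| <= a -> d 1%g (ci x) < e.
Proof.
move=> e0; have /(lc_nbhs Hc) [a a0 aP] : nbhs (1%g : U) [set u | d 1%g u < e].
  by apply/(Defs.metric_nbhs hd); exists e.
by exists a.
Qed.

Lemma left_dist (g h : U) : left_invariant d -> d g h = d 1%g (g^-1 * h)%g.
Proof. by move=> dl; rewrite -(dl g 1%g) mulg1 mulgA mulgV mul1g. Qed.

Lemma right_dist (g h : U) : right_invariant d -> d g h = d 1%g (h * g^-1)%g.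
Proof. by move=> dr; rewrite -(dr g 1%g) mul1g mulgVK. Qed.

End LogMetric.

Lemma small_enough (R : realType) (A b : R) : 0 < b -> exists2 x, 0 < x & A * x <= b.
Proof.
move=> b0; exists (b / (`|A| + 1)); first by rewrite divr_gt0// ltr_wpDl.
have A1 : 0 < `|A| + 1 by rewrite ltr_wpDl.
rewrite mulrA ler_pdivrMr// mulrC ler_wpM2l ?(ltW b0)//.
by have := ler_norm A; lra.
Qed.

(** * Uniform statements for an invariant metric *)

Section Main.
Variables (R : realType) (U : topGroupType) (E : completeNormedModType R).
Variables (ci : E -> U) (Hc : log_chart ci) (d : U -> U -> R) (hd : complete_metric d).
Variables (hinv : left_invariant d \/ right_invariant d).

Lemma near_hom_metric (L eps : R) : 1 <= L -> 0 < eps ->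
  exists2 delta : R, 0 < delta &
    forall (K : topGroupType), compact [set: K] ->
    forall phi : K -> U, continuous phi -> (forall s, conj_lip ci L (phi s)) ->
      (forall s t : K, d (phi (s * t)%g) (phi s * phi t)%g < delta) ->
      exists2 psi : K -> U, top_morphism psi & eps_close d eps phi psi.
Proof.
move=> L1 eps0.
have eps2 : 0 < eps / 2 by rewrite divr_gt0.
have [a0 a00 a0P] := log_metric Hc hd eps2.
have [c1 c10 c1P] := @small_enough R (100 * (L * 4) * (L * 4)) 1 ltr01.
have [c2 c20 c2P] := @small_enough R (4 * L) (Num.min a0 1) ltac:(by rewrite lt_min a00 ltr01).
pose c := Num.min c1 c2.
have c0 : 0 < c by rewrite lt_min c10.
have [c_1 c_2] : c <= c1 /\ c <= c2 by rewrite /c !ge_min !lexx orbT.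
have {}c1P : 100 * (L * 4) * (L * 4) * c <= 1.
  by apply: le_trans c1P; apply: ler_wpM2l => //; rewrite !mulr_ge0//; lra.
have [cL4 cL1] : 4 * L * c <= a0 /\ 4 * L * c <= 1.
  apply/andP; rewrite -le_min; apply: le_trans c2P; apply: ler_wpM2l => //; lra.
have cL : c <= L * c by rewrite ler_peMl// ltW.
have [a aP aL] := @small_enough R (4 * L) c c0.
have [e0 e00 e0P] := metric_log Hc hd aP.
have q0 : (0 : R) < 1 / 4 by rewrite divr_gt0.
have [e1 e10 e1P] := metric_log Hc hd q0.
exists (Num.min e0 (e1 / 2)); first by rewrite lt_min e00 divr_gt0.
move=> K Kc phi phic phiL phid.
have phid0 s t : d (phi (s * t)%g) (phi s * phi t)%g < e0
  by have := phid s t; rewrite lt_min => /andP [].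
have phid1 s t : d (phi (s * t)%g) (phi s * phi t)%g < e1 / 2
  by have := phid s t; rewrite lt_min => /andP [].
(* The hypothesis only covers values of [phi]. Since [phi s * phi s^-1] is near [phi 1] and [phi 1]
   is near the identity, each within [e1 / 2], the inverse of [phi s] is [phi s^-1] times a small
   factor. *)
have phiVL s : conj_lip ci (4 * L) (phi s)^-1%g.
  have h1 : d 1%g (phi 1%g) < e1 / 2.
    have := phid1 1%g 1%g; rewrite mulg1; case: hinv => dd.
      by rewrite (left_dist _ _ dd) mulgA mulVg mul1g.
    by rewrite (right_dist _ _ dd) mulgK.
  have := phid1 s (s^-1)%g; rewrite mulgV => h2.
  have [|w wE wb] := e1P (phi s * phi (s^-1))%g.
    by have := Defs.metric_triangle hd 1%g (phi 1%g) (phi s * phi (s^-1))%g; lra.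
  have h12 : (1 / 4 : R) <= 1 / 2 by lra.
  have [v [vE _ vb]] := apx_inv Hc h12 (apx_exact ci wb).
  have -> : (phi s)^-1%g = (phi (s^-1) * ci v)%g.
    by rewrite -vE -wE invgM mulgA mulgV mul1g.
  rewrite mulrC; apply: conj_lipM => //; first lra.
  by apply: (conj_lip_small Hc); lra.
have phidef : defect_le ci c phi.
  (* A left-invariant metric measures the defect to the right of [phi t], a right-invariant one to
     the left of [phi s]. Conjugation by [phi t], resp. by [(phi s)^-1], moves it to the middle. *)
  move=> s t; case: hinv => dd.
    have [|x xE xa] := e0P ((phi s * phi t)^-1 * phi (s * t))%g.
      by rewrite -(left_dist _ _ dd) (Defs.metric_sym hd); exact: phid0.
    have [|y yE yb] := phiL t x.
      have : L * `|x| <= L * a by rewrite ler_wpM2l//; lra.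
      lra.
    exists y; first by rewrite -yE -xE invgM !mulgA mulgV mul1g.
    apply: le_trans yb _; have : L * `|x| <= L * a by rewrite ler_wpM2l//; lra.
    lra.
  have [|x xE xa] := e0P (phi (s * t) * (phi s * phi t)^-1)%g.
    by rewrite -(right_dist _ _ dd) (Defs.metric_sym hd); exact: phid0.
  have [|y yE yb] := phiVL s x.
    have : 4 * L * `|x| <= 4 * L * a by rewrite ler_wpM2l//; lra.
    lra.
  exists y; first by rewrite -yE -xE invgM invgK !mulgA mulgVK.
  apply: le_trans yb _; have : 4 * L * `|x| <= 4 * L * a by rewrite ler_wpM2l//; lra.
  lra.
have [psi psiM psiP] := near_hom_of_defect Hc (metric_hausdorff hd) Kc phic L1 c0 c1P phiL phidef.
exists psi => //; apply: eps_close_half => // s; apply: ltW.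
have [v -> vb] := psiP s; case: hinv => dd.
  rewrite (left_dist _ _ dd) mulKg; apply: a0P.
  have : 0 <= (L - 1) * c by rewrite mulr_ge0//; lra.
  lra.
rewrite (right_dist _ _ dd).
have Lv : L * `|v| <= L * (4 * c) by rewrite ler_wpM2l//; lra.
have [|y -> yb] := phiL s v; first lra.
by apply: a0P; lra.
Qed.

Lemma near_subgroup_metric (G : set U) (F : set E) (L eps : R) :
  is_subgroup G -> closed_subspace F ->
  (forall x, `|x| <= 1 -> (G (ci x) <-> F x)) -> 1 <= L -> 0 < eps ->
  exists2 V : set U, nbhs (1%g : U) V &
    forall K : topGroupType, compact [set: K] ->
    forall phi : K -> U, top_morphism phi -> (forall s, conj_lip ci L (phi s)) ->
      range phi `<=` [set (g * u)%g | g in G & u in V] ->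
      exists z : U, (forall s, G (z^-1 * phi s * z)%g) /\
        eps_close d eps phi (fun s => z^-1 * phi s * z)%g.
Proof.
move=> GG FF GF L1 eps0.
have eps2 : 0 < eps / 2 by rewrite divr_gt0.
have [a0 a00 a0P] := log_metric Hc hd eps2.
have [c1 c10 c1P] := @small_enough R (200 * (16 * L) * (16 * L)) 1 ltr01.
have [c2 c20 c2P] := @small_enough R (36 * L) (Num.min a0 1) ltac:(by rewrite lt_min a00 ltr01).
pose a := Num.min c1 c2.
have a_0 : 0 < a by rewrite lt_min c10.
have [c_1 c_2] : a <= c1 /\ a <= c2 by rewrite /a !ge_min !lexx orbT.
have {}c1P : 200 * (16 * L) * (16 * L) * a <= 1.
  by apply: le_trans c1P; apply: ler_wpM2l => //; rewrite !mulr_ge0//; lra.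
have [aL aL1] : 36 * L * a <= a0 /\ 36 * L * a <= 1.
  apply/andP; rewrite -le_min; apply: le_trans c2P; apply: ler_wpM2l => //; lra.
have LA : a <= L * a by rewrite ler_peMl// ltW.
(* The assumption provides products in [G * V], whereas [conj_into_subgroup] asks for the small
   factor on the left. Inverting the decomposition of [phi s^-1] exchanges the sides and at most
   doubles the radius. *)
exists [set ci v | v in [set v : E | `|v| <= a / 2]].
  by apply: (log_ball_nbhs Hc); rewrite divr_gt0.
move=> K Kc phi phiM phiL phiG.
have [_ phiH] := phiM.
have phi1 : phi 1%g = 1%g by apply: (mulgI (phi 1%g)); rewrite -phiH !mulg1.
have phiV s : phi (s^-1)%g = (phi s)^-1%g.
  by apply: (mulgI (phi s)); rewrite -phiH !mulgV phi1.
have [|x xb xG] := conj_into_subgroup Hc Kc phiM GG FF GF L1 a_0 c1P phiL.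
  move=> s; have [g Gg [_ [v /= vb <-] gv]] := phiG (phi (s^-1)%g) (ex_intro2 _ _ _ I erefl).
  have a12 : a / 2 <= 1 / 2 by lra.
  have [y [yE _ yb]] := apx_inv Hc a12 (apx_exact ci vb).
  exists y, (g^-1)%g; split.
  - by rewrite -yE -invgM gv phiV invgK.
  - lra.
  - by case: GG => _ _; apply.
exists (ci x); split => //; apply: eps_close_half => // s; apply: ltW.
have h4 : 4 * a <= 1 / 2 by lra.
have [y [yE _ yb]] := apx_inv Hc h4 (apx_exact ci xb).
have close (w z : E) : `|w| <= 8 * (L * a) -> `|z| <= 8 * (L * a) ->
    d 1%g (ci w * ci z)%g < eps / 2.
  move=> w8 z8; have [||q -> qb] := lc_mul Hc (x := w) (y := z); [lra|lra|].
  apply: a0P.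
  have -> : q = (q - (w + z)) + (w + z) by rewrite subrK.
  apply: le_trans (ler_normD _ _) _; have := ler_normD w z.
  have : `|w| * `|z| <= 1 * `|z| by rewrite ler_wpM2r//; lra.
  have := normr_ge0 z; lra.
(* The quotient of [phi s] and its conjugate is a commutator of [phi s] and [ci x]. Grouped as one
   conjugate by a value of [phi] next to one small factor, it is a product of two small elements. *)
case: hinv => dd.
  rewrite (left_dist _ _ dd) yE.
  have Ly : L * `|y| <= L * (8 * a) by rewrite ler_wpM2l//; lra.
  have [|w wE wb] := phiL (s^-1)%g y; first lra.
  rewrite phiV invgK in wE.
  by rewrite !mulgA wE; apply: close; lra.
rewrite (right_dist _ _ dd) yE.
have Lx : L * `|x| <= L * (4 * a) by rewrite ler_wpM2l//; lra.
have [|w wE wb] := phiL s x; first lra.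
by rewrite -!mulgA [(phi s * _)%g]mulgA wE; apply: close; lra.
Qed.

End Main.

Theorem theoremA (R : realType) (U : banachLieGroup R) (d : U -> U -> R)
    (hd : complete_metric d) (hinv : left_invariant d \/ right_invariant d)
    (S : set U) (hS : ad_bounded S) :
  (forall eps : R, 0 < eps ->
    exists2 delta : R, 0 < delta &
    forall (K : topGroupType), compact_group K ->
    forall phi : K -> U, continuous phi -> range phi `<=` S ->
      (forall s t : K, d (phi (s * t)%g) (phi s * phi t)%g < delta) ->
      exists2 psi : K -> U, top_morphism psi & eps_close d eps phi psi)
  /\
  (forall G : set U, lie_subgroup G ->
    forall eps : R, 0 < eps ->
    exists2 V : set U, nbhs (1%g : U) V &
    forall (K : topGroupType), compact_group K ->
    forall phi : K -> U, top_morphism phi ->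
      range phi `<=` [set (g * u)%g | g in G & u in V] `&` S ->
      (exists psi : K -> U,
        [/\ top_morphism psi, range psi `<=` G & eps_close d eps phi psi]) /\
      (embedding phi ->
        exists psi : K -> U,
          [/\ embedding psi, range psi `<=` G & eps_close d eps phi psi])).
Proof.
have [M SM] : exists2 M : R, 0 <= M & forall g, S g -> (op_norm (Ad g) <= M%:E)%E.
  have [M SM] := hS; exists (Num.max M 0); first by rewrite le_max lexx orbT.
  by move=> g /SM /le_trans; apply; rewrite lee_fin le_max lexx.
move=> SM'.
split.
  move=> eps eps0.
  have ac : admissible (chart_at (1%g : U)) by move=> x; exact: chart_at_compatible.
  have d1 := chart_at_dom (1%g : U).
  have [lam [l0 Hc _]] := normalized_log_chart ac d1.
  have [L L1 LP] := conj_lip_of_Ad ac d1 l0 Hc SM.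
  have [delta delta0 deltaP] := near_hom_metric Hc hd hinv L1 eps0.
  exists delta => // K [Kc _] phi phic phiS; apply: deltaP => // s.
  by apply: LP; apply: SM'; apply: phiS; exists s.
move=> G [GG Gs] eps eps0.
(* The coordinates are now built on the submanifold chart at the identity, in which [G] is the
   subspace [F], instead of the chart chosen by the atlas. *)
have [G1 _ _] := GG; have [c [F [ac d1 [FF _] cG]]] := Gs _ G1.
have [lam [l0 Hc ran]] := normalized_log_chart ac d1.
have [L L1 LP] := conj_lip_of_Ad ac d1 l0 Hc SM.
have GF := normalized_subgroup d1 l0 G1 FF cG ran.
have [V nV VP] := near_subgroup_metric Hc hd hinv GG FF GF L1 eps0.
exists V => // K [Kc _] phi phiM phiGS.
have [||z [zG zc]] := VP K Kc phi phiM.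
- by move=> s; apply: LP; apply: SM'; have [|_ ] := phiGS (phi s); first exists s.
- by move=> u /phiGS [].
have psiM : top_morphism (fun s => z^-1 * phi s * z)%g.
  have [phic phiH] := phiM; split.
    move=> s; apply: cvg_mulg; last exact: cvg_cst.
    by apply: cvg_mulg; [exact: cvg_cst|exact: phic].
  by move=> s t; rewrite phiH !mulgA mulgK.
have psiG : range (fun s => z^-1 * phi s * z)%g `<=` G by move=> _ [s _ <-].
split; first by exists (fun s => z^-1 * phi s * z)%g.
move=> [_ phi_inj]; exists (fun s => z^-1 * phi s * z)%g; split => //.
by split => // s t /mulIg /mulgI /phi_inj.
Qed.
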